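(* Let $F$ be an algebraically closed field and let $\lambda=(\lambda_1,\lambda_2,\ldots,\lambda_l)$, $\lambda_1\ge\lambda_2\ge\cdots\ge\lambda_l\ge 1$, be a partition of $n$ such that $r_\lambda=2$. Let $B\in M_n(F)$ be a nilpotent matrix whose Jordan canonical form is determined by $\lambda$. Then $\mathcal{D}(\lambda)=(i_\lambda,\,n-i_\lambda)$, where $i_\lambda$ is the maximal index of nilpotency of an element of $\mathcal{N}_B$, and it is given by $$i_\lambda=\max_{1\le i<l}\left\{2(i-1)+\lambda_i+\lambda_{i+1}+\cdots+\lambda_{i+r}\;:\; \lambda_i-\lambda_{i+r}\le 1,\ \ \lambda_{i-1}\ge 2 \text{ if } i>1\right\},$$ where the maximum is taken over all integers $i$ with $1\le i<l$ and all integers $r\ge 0$ satisfying the displayed conditions.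
   Context: $M_n(F)$ is the algebra of $n\times n$ matrices over $F$, and the partition determined by the Jordan canonical form of a nilpotent matrix is the partition of $n$ given by its Jordan block sizes. For a nilpotent $B$, the nilpotent commutator is $\mathcal{N}_B=\{A\in M_n(F): A\text{ nilpotent},\ AB=BA\}$, known to be an irreducible variety (Zariski topology). For a partition $\mu$ of $n$, $\mathcal{O}_\mu$ is the $\mathrm{GL}_n(F)$-conjugation orbit of nilpotent matrices with Jordan partition $\mu$. If $B$ has Jordan partition $\lambda$, there is a unique partition $\mu$ of $n$ such that $\mathcal{O}_\mu\cap\mathcal{N}_B$ is dense in $\mathcal{N}_B$, and one defines $\mathcal{D}(\lambda)=\mu$. The index of nilpotency of a nilpotent matrix $A$ is the least integer $k\ge1$ with $A^k=0$. A partition is called almost rectangular if its largest and smallest parts differ by at most one. $r_\lambda$ denotes the smallest number $s$ such that $\lambda$ is a union (as a multiset of parts) of $s$ almost rectangular partitions. Convention: $\lambda_j=0$ for $j>l$. *)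

(* Defs.v *)
From mathcomp Require Export all_boot all_algebra.
From mathcomp Require Export mpoly.

Set Implicit Arguments.
Unset Strict Implicit.
Unset Printing Implicit Defensive.

Import GRing.Theory.
Local Open Scope ring_scope.

Definition is_least (P : nat -> Prop) (m : nat) : Prop :=
  P m /\ forall k, P k -> (m <= k)%N.

Definition is_greatest (P : nat -> Prop) (m : nat) : Prop :=
  P m /\ forall k, P k -> (k <= m)%N.

Definition is_partition (n : nat) (mu : seq nat) : Prop :=
  [/\ sorted geq mu, all (leq 1) mu & sumn mu = n].

(* The parts are in decreasing order, so [head] is the largest part and [last]
   the smallest. *)
Definition almost_rectangular (mu : seq nat) : Prop :=
  is_partition (sumn mu) mu /\ (head 0 mu - last 0 mu <= 1)%N.

Definition union_of_almost_rectangular (lam : seq nat) (s : nat) : Prop :=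
  exists mus : seq (seq nat),
    [/\ size mus = s,
        forall mu, mu \in mus -> almost_rectangular mu
      & perm_eq (flatten mus) lam].

(* [r_is lam s] means r_lam = s. *)
Definition r_is (lam : seq nat) (s : nat) : Prop :=
  is_least (union_of_almost_rectangular lam) s.

(* The part lam_j, with j counted from 1 and lam_j = 0 for j > size lam. *)
Definition part (lam : seq nat) (j : nat) : nat := nth 0%N lam j.-1.

(* The natural number subtraction below is never truncated when lam is sorted
   in decreasing order and 1 <= i. *)
Definition index_candidate (lam : seq nat) (k : nat) : Prop :=
  exists i r : nat,
    [/\ (1 <= i < size lam)%N,
        (part lam i - part lam (i + r) <= 1)%N,
        ((1 < i)%N -> (2 <= part lam (i - 1))%N)
      & k = (2 * (i - 1) + \sum_(i <= j < (i + r).+1) part lam j)%N].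

Section Matrices.
Variables (F : fieldType) (n : nat).
Implicit Types A B : 'M[F]_n.

Definition mx_nilpotent A : Prop := exists k : nat, A ^+ k = 0.

Definition nilpotency_index A (m : nat) : Prop :=
  is_least (fun k => (1 <= k)%N /\ A ^+ k = 0) m.

Definition nilpotent_commutator B A : Prop :=
  mx_nilpotent A /\ comm_mx A B.

End Matrices.

Definition nilpotent_jordan_block (F : fieldType) (k : nat) : 'M[F]_k :=
  \matrix_(i, j) (i.+1 == j :> nat)%:R.

Definition nilpotent_jordan_mx (F : fieldType) (mu : seq nat) :
    'M[F]_(\sum_(i < size mu) nth 0%N mu i) :=
  \mxdiag_(i < size mu) nilpotent_jordan_block F (nth 0%N mu i).

(* As a predicate on A, this is the GL_n(F)-conjugation orbit O_mu. *)
Definition jordan_partition (F : fieldType) (n : nat) (mu : seq nat)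
    (A : 'M[F]_n) : Prop :=
  is_partition n mu /\
  exists e : (\sum_(i < size mu) nth 0 mu i)%N = n,
    A ~_{in unitmx} castmx (e, e) (nilpotent_jordan_mx F mu).

Section Zariski.
Variables (F : fieldType) (n : nat).
Implicit Types (S X Z : 'M[F]_n -> Prop) (A : 'M[F]_n).

Definition zariski_closed Z : Prop :=
  exists I : {mpoly F[n * n]} -> Prop,
    forall A, Z A <-> forall p, I p -> p.@[fun k => mxvec A 0 k] = 0.

Definition zariski_closure S A : Prop :=
  forall Z, zariski_closed Z -> (forall C, S C -> Z C) -> Z A.

(* S is a dense subset of X for the topology induced on X. *)
Definition zariski_dense_in S X : Prop :=
  (forall A, S A -> X A) /\ (forall A, X A -> zariski_closure S A).

End Zariski.

(* [D_is F n lam mu] means D(lam) = mu: for B with Jordan partition lam, mu is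
   the unique partition of n such that the intersection of O_mu and N_B is dense
   in N_B. *)
Definition D_is (F : fieldType) (n : nat) (lam mu : seq nat) : Prop :=
  forall B : 'M[F]_n, jordan_partition lam B ->
    unique (fun nu : seq nat =>
      is_partition n nu /\
      zariski_dense_in
        (fun A => jordan_partition nu A /\ nilpotent_commutator B A)
        (nilpotent_commutator B)) mu.

(* Main.v *)
Require Import Defs.
From mathcomp Require Import zify perm.

(** Let V = F^n with the variable t of F[t] acting as B.  Then V is the direct
    sum of modules F[t]/(t^lam_a) with generators v_a, and a matrix commuting
    with B is a polynomial matrix Q, sending v_a to the sum of the Q_ab(t) v_b,
    where t^(lam_b - lam_a) divides Q_ab.  The proof compares V with these
    polynomial matrices ([eval_mx], [jordan_generators]).

    The commutator as a union of linear spaces.  If A commutes with B and is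
    nilpotent, the constant term Q(0) of its matrix is nilpotent and block
    triangular, so that a change of generators that keeps their orders makes it
    strictly upper triangular ([adapted_generators]).  Conversely the matrices Q
    with Q(0) strictly upper triangular ([strict_mx]) form a linear space, and
    all of them act nilpotently.  Hence, up to conjugation in the centralizer of
    B, A and any two prescribed witnesses lie in one linear space of elements of
    N_B.  On a line of that space a nonempty open condition fails at finitely
    many points only ([closure_along_line]); this replaces the irreducibility
    of N_B.

    The maximal index.  A nonzero coefficient of Q^e is carried by a chain of
    e + 1 basis vectors t^k v_a, each step weakly increasing k, weakly decreasing
    lam_a - k, and passing to a larger row when nothing else changes.  A
    potential argument ([chain_size_le_uchain]) bounds the length of such a chain
    by that of a U-chain, which goes through all basis vectors of the strings of
    lengths p and p - 1 and through both ends of the longer strings.  The lengths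
    of U-chains have the same maximum T as the numbers in the displayed formula
    ([candidate_le_max_chain], [max_chain_candidate]).  For each part p
    of lam, a power of some strict matrix runs through the U-chain of level p
    ([long_walk_uchain]), so that T is the maximal index of nilpotency.

    The generic Jordan type.  As lam splits into two almost rectangular
    partitions, two cyclic walks through the strings give an element of N_B of
    rank at least n - 2 ([rank_two_cycles]); as lam is not almost rectangular,
    T < n ([max_chain_lt]).  A generic A in N_B therefore has rank at least n - 2
    and A^(T-1) <> 0 = A^T.  Such a matrix has Jordan type (T, n - T) and
    no other ([jordan_pair], [jordan_pair_unique]), and an orbit that is dense in
    N_B contains such a matrix. *)

Set Implicit Arguments.
Unset Strict Implicit.
Unset Printing Implicit Defensive.
Import GRing.Theory.

(** * Columns of a partition and the weights of its U-chains *)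

Section PartitionColumns.
Variable lam : seq nat.

(** The parts of the conjugate partition. *)
Definition parts_ge q := count (leq q) lam.

Lemma parts_ge_anti p q : p <= q -> parts_ge q <= parts_ge p.
Proof. by move=> pq; apply: sub_count => x /=; apply: leq_trans. Qed.

(** The number of basis vectors in a Jordan string of length x that lie on the
    U-chain of level p: all of them if x is p or p - 1, and the two ends if x is
    larger. *)
Definition weight p x := if p < x then 2 else if p <= x.+1 then x else 0.

Definition uchain p := \sum_(x <- lam) weight p x.

Definition max_chain := \max_(p <- lam) uchain p.

Lemma uchain_nat p M : 0 < p -> size lam <= M ->
  uchain p = \sum_(0 <= a < M) weight p (nth 0 lam a).
Proof.
move=> p_gt0 lM; rewrite (big_cat_nat (n := size lam)) //= [X in _ = _ + X]big1_seq.
  by rewrite addn0 /uchain (big_nth 0).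
move=> a /andP[_]; rewrite mem_index_iota => /andP[la _].
by rewrite nth_default // /weight; do ?case: ifP; lia.
Qed.

Lemma max_chain_attained : lam != [::] ->
  exists2 p, p \in lam & max_chain = uchain p.
Proof.
rewrite /max_chain; move: uchain => f lam_n0.
elim: lam lam_n0 => // x [|y s] IHs _; first by exists x; rewrite ?mem_head ?big_seq1.
rewrite big_cons; have [//|p ps ->] := IHs.
case: (leqP (f x) (f p)) => [_|_]; first by exists p; rewrite // inE ps orbT.
by exists x; rewrite ?mem_head.
Qed.

Lemma uchain_le_max p : p \in lam -> uchain p <= max_chain.
Proof. by move=> lam_p; rewrite /max_chain; apply: leq_bigmax_seq. Qed.

Hypothesis lam_gt0 : all (leq 1) lam.

Lemma parts_ge0 : parts_ge 0 = parts_ge 1.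
Proof. by rewrite /parts_ge (eq_in_count (a2 := leq 1)) // => x /(allP lam_gt0) ->. Qed.

(** The form in which the potential argument of [chain_size_le_uchain] produces
    the length of a U-chain. *)
Lemma uchainE p : 0 < p ->
  uchain p = p.-1 * (parts_ge p.-1 - parts_ge p.+1) + parts_ge p + parts_ge p.+1.
Proof.
move=> p_gt0; have := @parts_ge_anti p.-1 p.+1 ltac:(lia).
suff : uchain p + p.-1 * parts_ge p.+1 =
  p.-1 * parts_ge p.-1 + parts_ge p + parts_ge p.+1 by nia.
rewrite /uchain /parts_ge; elim: lam lam_gt0 => [|x s IHs] /=.
  by rewrite big_nil; lia.
case/andP=> x_gt0 /IHs {IHs}; rewrite big_cons /weight.
by do ?case: leqP => ?; nia.
Qed.

(** Equality would mean [weight p x = x] for every part x, and then the parts take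
    at most two values, which are consecutive. *)
Lemma max_chain_lt : 1 < head 0 lam - last 0 lam -> max_chain < sumn lam.
Proof.
move=> lam_wide; have lam_n0 : lam != [::] by case: lam lam_wide.
have [p lam_p ->] := max_chain_attained lam_n0.
have p_gt0 : 0 < p := allP lam_gt0 _ lam_p.
have [le_sum eq_sum] : uchain p <= sumn lam /\
    (uchain p = sumn lam -> {in lam, forall x, weight p x = x}).
  rewrite /uchain; elim: lam lam_gt0 => [|x s IHs] /=; first by rewrite big_nil.
  case/andP=> x_gt0 /IHs[le_s eq_s]; rewrite big_cons.
  have le_x : weight p x <= x by rewrite /weight; do ?case: ifP; lia.
  split=> [|eq_xs]; first by lia.
  have eqx : weight p x = x by lia.
  by move=> y; rewrite inE => /predU1P[->//|/eq_s]; apply; lia.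
rewrite ltn_neqAle le_sum andbT; apply/negP => /eqP /eq_sum eq_w.
case: lam lam_wide eq_w lam_gt0 {le_sum eq_sum lam_p lam_n0} => //= x s wide eq_w.
case/andP=> x_gt0 s_gt0.
have lx : last x s \in x :: s by apply: mem_last.
have l_gt0 : 0 < last x s by move: lx; rewrite inE => /predU1P[->//|/(allP s_gt0)].
have := eq_w _ lx; have := eq_w _ (mem_head x s).
by rewrite /weight; do ?case: ifP; lia.
Qed.

End PartitionColumns.

Section SortedPartition.
Variable lam : seq nat.
Hypothesis lam_sorted : sorted geq lam.
Notation N := (parts_ge lam).

Lemma ltn_parts_ge a q : 0 < q -> (a < parts_ge lam q) = (q <= nth 0 lam a).
Proof.
move=> q_gt0; rewrite /parts_ge; elim: lam lam_sorted a => [|x s IHs] /=.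
  by move=> _ a; rewrite nth_nil; lia.
move=> s_path; have {}IHs := IHs (path_sorted s_path).
have xs : all (geq x) s.
  by apply: order_path_min s_path => u v w /= ? ?; lia.
move=> a; case: (leqP q x) => [qx|xq]; last first.
- have s0 : count (leq q) s = 0.
    apply/eqP; rewrite -leqn0 leqNgt -has_count.
    by apply/hasPn => y /(allP xs) /=; lia.
  by rewrite s0; case: a => [|a] /=; [lia | rewrite -IHs s0; lia].
- by case: a => [|a] //=; rewrite add1n ltnS IHs.
Qed.

Lemma nth_anti a b : a <= b -> nth 0 lam b <= nth 0 lam a.
Proof.
move=> ab; case: (ltnP b (size lam)) => [bl|/(nth_default 0)->//].
apply: (sorted_leq_nth (leT := geq)) => //; rewrite ?inE ?(leq_ltn_trans ab) //.
- by move=> x y z /= ? ?; lia.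
- by move=> x /=.
Qed.

Lemma mem_parts p : 0 < p -> N p.+1 < N p -> p \in lam.
Proof.
move=> p_gt0 lt_p; have := @ltn_parts_ge (N p.+1) p.+1 isT.
have := @ltn_parts_ge (N p.+1) p p_gt0; rewrite lt_p ltnn.
move=> /esym le_p /esym/negbT gt_p.
have pE : nth 0 lam (N p.+1) = p by lia.
rewrite -{1}pE mem_nth //; case: ltnP => // /(nth_default 0) p0; lia.
Qed.

Lemma nth_level q a : 0 < q -> N q.+1 <= a < N q -> nth 0 lam a = q.
Proof.
move=> q_gt0; have := @ltn_parts_ge a q.+1 isT.
by have := @ltn_parts_ge a q q_gt0; lia.
Qed.

End SortedPartition.

(** * Chains of cells *)

Section Chains.
Variable lam : seq nat.
Hypothesis lam_sorted : sorted geq lam.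

Notation N := (parts_ge lam).
Notation part0 := (nth 0 lam).

(** The cell (a, k) stands for the basis vector v_a B^k of the a-th Jordan string.
    A matrix commuting with B cannot bring a vector closer to the top of its
    string, nor take it further from the bottom: these are the first two
    conditions.  The third one, an order on strings of equal length, makes the
    relation strict. *)
Definition cell_step (x y : nat * nat) :=
  [&& x.2 <= y.2, part0 y.1 + x.2 <= part0 x.1 + y.2
    & (x.2 == y.2) ==> (x.1 < y.1)].

(** Its drop from q - 1 to q is the number of parts equal to q - 1 or q. *)
Definition two_levels q := N q + N q.+1.
Local Notation S2 := two_levels.

Section Potential.
Variables sigma p c : nat.
Hypothesis c_max : forall j, sigma <= j.+1 -> S2 j <= S2 j.+1 + c.

(** Constant up to level p; beyond, the increase from q to q + 1 is what a walk
    loses when it moves between these two levels instead of p - 1 and p, where c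
    is the number of parts equal to p - 1 or p. *)
Definition climb q := maxn q p * c + S2 (maxn q p).

Lemma two_levels_drop q d : sigma <= q -> S2 q <= S2 (q + d) + d * c.
Proof.
move=> sq; elim: d => [|d IHd]; first by rewrite addn0; lia.
by have := @c_max (q + d) ltac:(lia); rewrite addnS; move: IHd; lia.
Qed.

Lemma climb_edge q d (q' := q + d) : sigma <= q -> 0 < d ->
  let m := (N q - N q.+1) + (N q' - N q'.+1) in
  climb q' + m <= climb q + d * c /\ climb q + m <= climb q' + d * c.
Proof.
move=> sq d_gt0.
have := @parts_ge_anti lam q q.+1 ltac:(lia).
have := @parts_ge_anti lam q.+1 q' ltac:(lia).
have := @parts_ge_anti lam q' q'.+1 ltac:(lia).
have := @two_levels_drop q d ltac:(lia).
rewrite /= /climb -/q'; case: (leqP q p) => [/subnKC qp|pq].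
  have := @two_levels_drop q (p - q) ltac:(lia); rewrite qp.
  case: (leqP q' p) => [q'p|/ltnW/subnKC pq'] drop_qp.
    by rewrite /S2; lia.
  have := @two_levels_drop p (q' - p) ltac:(lia); rewrite pq'.
  have -> : d * c = (p - q) * c + (q' - p) * c by rewrite -mulnDl; congr (_ * _); lia.
  have -> : q' * c = p * c + (q' - p) * c by rewrite -mulnDl pq'.
  by move: drop_qp; rewrite /S2; lia.
have -> : maxn q' p = q' by lia.
have -> : q' * c = q * c + d * c by rewrite -mulnDl.
by rewrite /S2; lia.
Qed.

(** With the terms of x and those of y brought to opposite sides, this is a
    potential that grows by at least 2 with each step, even after paying for the
    change of [climb] in either direction.  To see it, go from one cell to the
    other through unit changes of k and of the level: each of them earns c, which
    pays for the parts at both end levels and for the change of [climb].  If k and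
    the level do not change, the row index grows. *)
Lemma cell_step_potential (x y : nat * nat) (q := part0 x.1) (q' := part0 y.1) :
  x.2 < q -> y.2 < q' -> sigma <= q -> sigma <= q' -> cell_step x y ->
  let lhs := (2 * x.2 + q') * c + S2 q' + 2 * x.1 + 2 in
  let rhs := (2 * y.2 + q) * c + S2 q + 2 * y.1 in
  lhs + climb q' <= rhs + climb q /\ lhs + climb q <= rhs + climb q'.
Proof.
case: x y @q @q' => [a k] [b k'] /= kq k'q' sq sq' /and3P[/= kk' lev kab].
have := @ltn_parts_ge lam lam_sorted a (part0 a) ltac:(lia).
have := @ltn_parts_ge lam lam_sorted a (part0 a).+1 ltac:(lia).
have := @ltn_parts_ge lam lam_sorted b (part0 b) ltac:(lia).
have := @ltn_parts_ge lam lam_sorted b (part0 b).+1 ltac:(lia).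
move: (part0 a) (part0 b) kq k'q' sq sq' lev => q q' kq k'q' sq sq' lev.
rewrite !leqnn !ltnn => lb ub la ua.
case: (ltngtP q q') => [lt_q|lt_q|eq_q].
- have [d q'E] : exists d, q' = q + d by exists (q' - q); lia.
  have [j k'E] : exists j, k' = k + d + j by exists (k' - k - d); lia.
  have [/=] := @climb_edge q d sq ltac:(lia); rewrite -q'E /S2 k'E.
  by nia.
- have [d qE] : exists d, q = q' + d by exists (q - q'); lia.
  have [j k'E] : exists j, k' = k + j by exists (k' - k); lia.
  have [/=] := @climb_edge q' d sq' ltac:(lia); rewrite -qE /S2 k'E.
  by nia.
- subst q'.
  have := c_max (j := q.-1) ltac:(lia).
  have := @parts_ge_anti lam q q.+1 ltac:(lia).
  have [eq_k|lt_k] : k = k' \/ k < k' by lia.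
    by subst k'; move: kab; rewrite eqxx /= /S2; lia.
  have [j k'E] : exists j, k' = k + j.+1 by exists (k' - k.+1); lia.
  have := @parts_ge_anti lam q.-1 q ltac:(lia).
  rewrite /S2 k'E (ltn_predK kq); nia.
Qed.

Lemma chain_potential (x : nat * nat) s (y := last x s)
    (q := part0 x.1) (q' := part0 y.1) :
  path cell_step x s ->
  {in x :: s, forall z, z.2 < part0 z.1 /\ sigma <= part0 z.1} ->
  let lhs := (2 * x.2 + q') * c + S2 q' + 2 * x.1 + 2 * size s in
  let rhs := (2 * y.2 + q) * c + S2 q + 2 * y.1 in
  lhs + climb q' <= rhs + climb q /\ lhs + climb q <= rhs + climb q'.
Proof.
rewrite {}/q {}/q' {}/y; elim: s x => [|z s IHs] x /=; first by lia.
case/andP=> xz zs in_s.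
have [kx sx] := in_s x (mem_head _ _).
have [kz sz] := in_s z ltac:(by rewrite !inE eqxx orbT).
have := IHs z zs (fun w ws => in_s w ltac:(by rewrite inE ws orbT)).
have := cell_step_potential kx kz sx sz xz.
move: (last z s) (part0 (last z s).1) (part0 x.1) (part0 z.1) => /=; lia.
Qed.

End Potential.

Lemma nth_le_head a : part0 a <= part0 0.
Proof.
have [->//|q_gt0] := posnP (part0 a).
by rewrite -ltn_parts_ge // (leq_ltn_trans (leq0n a)) // ltn_parts_ge.
Qed.

(** The least and the greatest cell: the top of the first and the bottom of the
    last of the longest strings. *)
Definition first_cell := (0, 0).
Definition last_cell := ((N (part0 0)).-1, (part0 0).-1).

Lemma first_cell_step (x : nat * nat) :
  x.2 < part0 x.1 -> x != first_cell -> cell_step first_cell x.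
Proof.
case: x => a k /= ka; rewrite /cell_step xpair_eqE /= => nx.
have := nth_le_head a; lia.
Qed.

Lemma last_cell_step (x : nat * nat) :
  x.2 < part0 x.1 -> x != last_cell -> cell_step x last_cell.
Proof.
case: x => a k /= ka; rewrite /cell_step xpair_eqE /= => nx.
have aL := nth_le_head a; have bL := nth_le_head (N (part0 0)).-1.
by have := @ltn_parts_ge lam lam_sorted a (part0 0) ltac:(lia); lia.
Qed.

Lemma last_cell_valid : 0 < part0 0 ->
  part0 last_cell.1 = part0 0 /\ last_cell.2 < part0 last_cell.1.
Proof.
move=> L_gt0; rewrite /last_cell /=.
have := @ltn_parts_ge lam lam_sorted 0 _ L_gt0.
have := @ltn_parts_ge lam lam_sorted (N (part0 0)).-1 _ L_gt0.
by have := nth_le_head (N (part0 0)).-1; lia.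
Qed.

Lemma chain_extend (x : nat * nat) s :
  path cell_step x s -> {in x :: s, forall z, z.2 < part0 z.1} ->
  exists s', [/\ path cell_step first_cell s', last first_cell s' = last_cell,
    {in first_cell :: s', forall z, z.2 < part0 z.1} & size s <= size s'].
Proof.
move=> xs valid.
have L_gt0 : 0 < part0 0.
  by have := valid x (mem_head _ _); have := nth_le_head x.1; lia.
have [s1 [path1 valid1 size1]] : exists s1, [/\ path cell_step first_cell s1,
    {in first_cell :: s1, forall z, z.2 < part0 z.1} & size s <= size s1].
  have [<-|nx] := eqVneq x first_cell; first by exists s.
  exists (x :: s); split=> //=; first by rewrite xs first_cell_step ?valid ?mem_head.
  by move=> z; rewrite inE => /predU1P[->|/valid].
set y := last first_cell s1.
have [yE|ny] := eqVneq y last_cell; first by exists s1.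
exists (rcons s1 last_cell); split.
- by rewrite rcons_path path1 last_cell_step // valid1 // mem_last.
- by rewrite last_rcons.
- move=> z; rewrite -rcons_cons mem_rcons inE => /predU1P[->|/valid1//].
  by have [] := last_cell_valid L_gt0.
- by rewrite size_rcons ltnW.
Qed.

Hypothesis lam_gt0 : all (leq 1) lam.

(** Extend the chain to go from the least to the greatest cell, and cut it at a
    cell of least level sigma.  Let p maximize, among the levels from sigma on,
    the number of parts equal to p or p - 1.  As [climb] is least at the cut and
    each half of the chain may use either sign of its variation, the telescoped
    potential bounds the size by [uchain lam p]. *)
Lemma chain_size_le_uchain (x : nat * nat) s :
  path cell_step x s -> {in x :: s, forall z, z.2 < part0 z.1} ->
  exists2 p, p \in lam & size s < uchain lam p.
Proof.
move=> xs /(chain_extend xs)[{xs} s' [path_s' last_s' valid le_s]].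
suff: exists2 p, p \in lam & size s' < uchain lam p.
  by case=> p lam_p ?; exists p => //; apply: leq_ltn_trans le_s _.
move: s' path_s' last_s' valid {s x le_s} => s s_path s_last valid.
have L_gt0 : 0 < part0 0 := valid _ (mem_head _ _).
pose L := part0 0.
have [z zs z_min] : exists2 z, z \in first_cell :: s &
    {in first_cell :: s, forall w, part0 z.1 <= part0 w.1}.
  have exv : exists n, has (fun w => part0 w.1 == n) (first_cell :: s).
    by exists L; rewrite /= eqxx.
  case: (ex_minnP exv) => n /hasP[z zs /eqP zn] n_min.
  exists z => // w ws; rewrite zn; apply: n_min.
  by apply/hasP; exists w.
pose sigma := part0 z.1; pose X q := N q.-1 - N q.+1.
have sigma_gt0 : 0 < sigma by apply: leq_ltn_trans (valid z zs).
have sigma_le : sigma <= L := nth_le_head z.1.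
have NL : N L.+1 = 0.
  by have := @ltn_parts_ge lam lam_sorted 0 L.+1 isT; rewrite ltnn; lia.
have NL_gt0 : 0 < N L by rewrite ltn_parts_ge.
pose o : 'I_L.+1 := inord sigma.
have oE : sigma <= o by rewrite inordK ?ltnS.
case: (@arg_maxnP 'I_L.+1 o (fun q => sigma <= q) (fun q => X q) oE) => p sp p_max.
have pL : p <= L by rewrite -ltnS.
have anti q q' := @parts_ge_anti lam q q'.
have c_max j : sigma <= j.+1 -> S2 j <= S2 j.+1 + X p.
  move=> sj; have X_le q : sigma <= q <= L -> X q <= X p.
    by case/andP=> sq qL; have /= := p_max (inord q); rewrite inordK ?ltnS //; apply.
  rewrite /S2; case: (leqP j.+1 L) => [jL|].
    have /= := X_le j.+1 ltac:(lia); rewrite /X /=.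
    have := anti j j.+1 ltac:(lia); have := anti j.+1 j.+2 ltac:(lia); lia.
  move=> Lj; have := X_le L ltac:(lia); rewrite /X NL subn0.
  have := anti L.-1 L ltac:(lia); have := anti L.+1 j.+1 ltac:(lia).
  have := anti L j ltac:(lia); lia.
have size_le : size s < uchain lam p.
  case/splitPl: zs s_path s_last valid z_min => s1 s2 zE.
  rewrite cat_path last_cat size_cat zE -cat_cons.
  case/andP=> path1 path2 s_last valid z_min.
  have := @chain_potential sigma p (X p) c_max first_cell s1 path1.
  have := @chain_potential sigma p (X p) c_max z s2 path2.
  rewrite zE s_last; have [-> _] := last_cell_valid L_gt0.
  have sub2 w : w \in z :: s2 -> w \in (first_cell :: s1) ++ s2.
    by rewrite mem_cat inE => /predU1P[->|->]; rewrite ?orbT // -zE mem_last.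
  case=> [w /sub2 ws|]; first by split; [apply: valid | apply: z_min].
  rewrite /last_cell -/L -/sigma /climb (maxn_idPr sp) (maxn_idPl pL) /S2 NL /=.
  move=> bound2 _ []; first by move=> w ws; rewrite valid ?z_min // mem_cat ws.
  move=> _ /=; rewrite -/L uchainE ?(leq_trans sigma_gt0) // -/(X p).
  move: bound2; set c := X p; clearbody c.
  have -> : p * c = p.-1 * c + c by rewrite -{1}(ltn_predK (leq_trans sigma_gt0 sp)) mulSn addnC.
  have -> : L * c = L.-1 * c + c by rewrite -{1}(ltn_predK (L_gt0 : 0 < L)) mulSn addnC.
  nia.
have Xp_gt0 : 0 < X p.
  have /= := p_max (inord L); rewrite inordK // => /(_ sigma_le).
  by have : 0 < X L; [rewrite /X NL; have := anti L.-1 L ltac:(lia); lia | lia].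
have p_gt0 : 0 < p := leq_trans sigma_gt0 sp.
(* If no part equals p, the level p - 1 is a part and does at least as well. *)
have [lt_p|ge_p] := ltnP (N p.+1) (N p); first by exists (p : nat); rewrite ?(mem_parts lam_sorted).
have p1_gt0 : 0 < p.-1.
  case: (posnP p.-1) Xp_gt0 => // p0; have pE : nat_of_ord p = 1 by lia.
  by move: ge_p; rewrite /X pE /= (parts_ge0 lam_gt0); lia.
(* The strings that count at level p then all have length p - 1. *)
have lt_p : N p.-1.+1 < N p.-1.
  by move: Xp_gt0; rewrite /X (ltn_predK p_gt0); have := anti p p.+1 ltac:(lia); lia.
exists p.-1; first exact: (mem_parts lam_sorted).
apply: leq_trans size_le _; rewrite !uchainE //.
have := anti p p.+1 ltac:(lia); have := anti p.-1.-1 p.-1 ltac:(lia).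
have := anti p.-1 p ltac:(lia).
move: ge_p; rewrite (ltn_predK p_gt0) => ? ? ? ?.
have -> : N p.+1 = N p by lia.
nia.
Qed.

Theorem chain_size_le_max (x : nat * nat) s :
  path cell_step x s -> {in x :: s, forall z, z.2 < part0 z.1} ->
  size s < max_chain lam.
Proof.
move=> xs /(chain_size_le_uchain xs)[p lam_p /leq_trans]; apply.
exact: uchain_le_max.
Qed.

End Chains.

(** * Lengths of U-chains as candidates for the index *)

Lemma leq_sum_nat (m n : nat) (E1 E2 : nat -> nat) :
  (forall a, m <= a < n -> E1 a <= E2 a) ->
  \sum_(m <= a < n) E1 a <= \sum_(m <= a < n) E2 a.
Proof.
by move=> le_E; rewrite big_nat [leqRHS]big_nat; apply: leq_sum.
Qed.

Section Candidates.
Variable lam : seq nat.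
Hypotheses (lam_sorted : sorted geq lam) (lam_gt0 : all (leq 1) lam).
Notation N := (parts_ge lam).
Notation part0 := (nth 0 lam).

(** Compare term by term with the U-chain of level [part lam i]: a row before the
    i-th contributes at least 2 to it, and the rows from i to i + r contribute in
    full. *)
Lemma candidate_le_max_chain k : index_candidate lam k -> k <= max_chain lam.
Proof.
case=> -[|h] [r [/= hl lev big_part ->]]; first by lia.
rewrite subn1 /=.
have {}hl : h < size lam by lia.
pose p := part0 h.
have lam_p : p \in lam by apply: mem_nth.
have p_gt0 : 0 < p := allP lam_gt0 _ lam_p.
apply: (@leq_trans (uchain lam p)); last exact: uchain_le_max.
have lev_e : p - part0 (h + r) <= 1 by move: lev; rewrite /part addSn.
pose M := maxn (size lam) (h + r).+1.
rewrite (@uchain_nat lam p M) ?leq_maxl // [leqRHS](big_cat_nat (n := h)) /=; try lia.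
rewrite [X in _ <= _ + X](big_cat_nat (m := h) (n := (h + r).+1)) /=; try lia.
rewrite addnA -[X in X <= _]addn0 leq_add // leq_add //.
  have -> : 2 * h = \sum_(0 <= a < h) 2 by rewrite sum_nat_const_nat subn0 mulnC.
  apply: leq_sum_nat => a /= ah.
  have le_p := @nth_anti lam lam_sorted a h ltac:(lia).
  have : 1 < part0 h.-1 by move: (big_part ltac:(lia)); rewrite /part subn1.
  have := @nth_anti lam lam_sorted a h.-1 ltac:(lia); rewrite -/p in le_p *.
  by rewrite /weight; do ?case: ifP; lia.
rewrite addSn big_add1 /=; apply: leq_sum_nat => a /andP[ha ae].
rewrite /part /=; have := @nth_anti lam lam_sorted h a ha.
have := @nth_anti lam lam_sorted a (h + r) ltac:(lia).
by rewrite -/p /weight; do ?case: ifP; lia.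
Qed.

(** The parts equal to p or p - 1 are in consecutive rows.  The last hypothesis
    says that the first of these rows is not the last row, as the range of i in a
    candidate demands. *)
Lemma uchain_candidate p : p \in lam -> N p.+1 + 1 < size lam ->
  index_candidate lam (uchain lam p).
Proof.
move=> lam_p hl; have p_gt0 : 0 < p := allP lam_gt0 _ lam_p.
have ge a := @ltn_parts_ge lam lam_sorted a.
pose h := N p.+1; pose e := N p.-1.
have ph : part0 h = p.
  have := ge h p.+1 isT; rewrite ltnn => /esym/negbT ph.
  have pi : index p lam < size lam by rewrite index_mem.
  have := nth_index 0 lam_p => pE.
  have hi : h <= index p lam by rewrite leqNgt ge // pE ltnn.
  have := @nth_anti lam lam_sorted h _ hi; rewrite pE; lia.
have he : h < e.
  have [p1|p1] := posnP p.-1; last by rewrite /e ge // ph; lia.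
  rewrite /e p1; apply: leq_trans (_ : size lam <= _); first by rewrite -/h in hl; lia.
  by rewrite /parts_ge (eq_count (a2 := predT)) ?count_predT.
have e_ge a : a < e -> p.-1 <= part0 a.
  by have [->//|p1] := posnP p.-1; rewrite /e ge.
have e_lt a : e <= a -> a < size lam -> part0 a < p.-1.
  have [p1|p1] := posnP p.-1; last by rewrite leqNgt /e ge // -ltnNge.
  by rewrite /e p1 /parts_ge (eq_count (a2 := predT)) ?count_predT //; lia.
have el : e <= size lam by apply: count_size.
exists h.+1, (e - h.+1); split; rewrite /part /= ?subn1 /=.
- by rewrite -/h in hl; lia.
- have := e_ge e.-1 ltac:(lia); rewrite ph.
  by rewrite (_ : h + (e - h.+1) = e.-1); lia.
- have := ge h.-1 p.+1 isT; rewrite -/h => geh h_gt0; lia.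
rewrite (@uchain_nat lam p (size lam)) // [LHS](big_cat_nat (n := h)) /=; try lia.
rewrite [X in _ + X = _](big_cat_nat (m := h) (n := e)) /=; try lia.
have -> : (h.+1 + (e - h.+1)).+1 = e.+1 by lia.
rewrite big_add1 /= -[RHS]addn0 -addnA; congr (_ + (_ + _)).
- rewrite mulnC -[in RHS](subn0 h) -sum_nat_const_nat; apply: eq_big_nat => a ah.
  by have := ge a p.+1 isT; rewrite -/h /weight; case: (p < _); lia.
- apply: eq_big_nat => a ah; have := ge a p.+1 isT; have := e_ge a ltac:(lia).
  by rewrite -/h /weight; do ?case: ifP; lia.
- apply: big1_seq => a /andP[_]; rewrite mem_index_iota => /andP[ea al].
  by have := e_lt a ea al; rewrite /weight; do ?case: ifP; lia.
Qed.

(** When the best level is that of the last row only, the level of the row above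
    it is as good. *)
Lemma max_chain_candidate : 1 < size lam ->
  index_candidate lam (max_chain lam).
Proof.
move=> size_lam; have lam_n0 : lam != [::] by case: lam size_lam.
have [p lam_p pE] := max_chain_attained lam_n0.
have [hl|lh] := ltnP (N p.+1 + 1) (size lam); first by rewrite pE; apply: uchain_candidate.
have p_gt0 : 0 < p := allP lam_gt0 _ lam_p.
have [l lE] : exists l, size lam = l.+2.
  by exists (size lam).-2; lia.
have ge := @ltn_parts_ge lam lam_sorted; rewrite lE in lh.
have lt_p : p < part0 l by rewrite -ge //; lia.
have last_p : part0 l.+1 = p.
  have := lam_p; rewrite -index_mem lE => il; have := nth_index 0 lam_p.
  have : l < index p lam by have := ge (index p lam) p.+1 isT; rewrite nth_index //; lia.
  by move=> li <-; congr nth; lia.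
have lam_p' : part0 l \in lam by rewrite mem_nth // lE.
have N_p' : N (part0 l).+1 <= l by rewrite leqNgt ge // ltnn.
suff le_u : uchain lam p <= uchain lam (part0 l).
  have -> : max_chain lam = uchain lam (part0 l).
    by apply/eqP; rewrite eqn_leq {1}pE le_u uchain_le_max.
  by apply: uchain_candidate => //; rewrite lE; lia.
rewrite !(@uchain_nat lam _ (size lam)) //; last by lia.
rewrite lE !big_nat_recr //= last_p -!addnA leq_add //.
  apply: leq_sum_nat => a /= al; have := @nth_anti lam lam_sorted a l ltac:(lia).
  by rewrite /weight; do ?case: ifP; lia.
by rewrite /weight; do ?case: ifP; lia.
Qed.

End Candidates.

(** * Unions of two almost rectangular partitions *)

Section TwoAlmostRectangular.
Variable lam : seq nat.
Hypothesis lam_part : is_partition (sumn lam) lam.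
Hypothesis r_lam : r_is lam 2.
Notation part0 := (nth 0 lam).

Lemma r2_wide : 1 < head 0 lam - last 0 lam.
Proof.
rewrite ltnNge; apply/negP => ar; have [_ /(_ 1)] := r_lam.
suff ur : union_of_almost_rectangular lam 1 by move/(_ ur).
exists [:: lam]; split=> // [mu|]; last by rewrite /= cats0.
by rewrite inE => /eqP ->.
Qed.

Lemma almost_rectangular_mem mu x : almost_rectangular mu -> x \in mu ->
  last 0 mu <= x <= (last 0 mu).+1.
Proof.
case=> -[srt _ _] wid xs.
have [i il <-] : exists2 i, i < size mu & nth 0 mu i = x.
  by exists (index x mu); rewrite ?index_mem ?nth_index.
rewrite -nth_last; move: wid; rewrite -nth0 -nth_last => wid.
have := @nth_anti mu srt i (size mu).-1 ltac:(lia).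
by have := nth_anti srt (leq0n i); lia.
Qed.

(** Let c be the larger one of the least parts of the two almost rectangular
    pieces.  The parts at least c and the parts below c are almost rectangular
    too, so that the pieces can be taken to be an initial and a final segment. *)
Lemma r2_threshold : exists h,
  [/\ 0 < h < size lam, part0 0 <= (part0 h.-1).+1 &
      part0 h <= (part0 (size lam).-1).+1].
Proof.
have [srt pos _] := lam_part.
have [[mus [size_mus ar_mus perm_mus]] _] := r_lam.
case: mus size_mus ar_mus perm_mus => [|mu1 [|mu2 [|? ?]]] //= _ ar; rewrite cats0 => mus_lam.
have ar1 := ar mu1 (mem_head _ _); have ar2 := ar mu2 (mem_last mu1 [:: mu2]).
pose c := maxn (last 0 mu1) (last 0 mu2); pose c' := minn (last 0 mu1) (last 0 mu2).
have mem_c x : x \in lam -> (c <= x <= c.+1) \/ (c' <= x <= c'.+1).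
  rewrite -(perm_mem mus_lam) mem_cat.
  case/orP=> [/(almost_rectangular_mem ar1)|/(almost_rectangular_mem ar2)];
  rewrite /c /c'; lia.
have c'c : c' <= c by rewrite /c /c'; lia.
have wide := r2_wide; rewrite -nth0 -nth_last in wide.
have anti := nth_anti srt.
have memp a : a < size lam -> (c <= part0 a <= c.+1) \/ (c' <= part0 a <= c'.+1).
  by move=> al; apply/mem_c/mem_nth.
have l_gt0 : 0 < size lam by case: lam wide.
have lv := memp (size lam).-1 ltac:(lia).
have fv := memp 0 l_gt0.
have c_gt0 : 0 < c by lia.
exists (parts_ge lam c); have ge := ltn_parts_ge srt.
have h_gt0 : 0 < parts_ge lam c by rewrite ge //; lia.
have hl : parts_ge lam c < size lam.
  rewrite ltnNge; apply/negP => lh.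
  by have := ge (size lam).-1 c c_gt0; lia.
split; first by lia.
  by have := ge (parts_ge lam c).-1 c c_gt0; lia.
by have := ge (parts_ge lam c) c c_gt0; have := memp (parts_ge lam c) hl; lia.
Qed.

End TwoAlmostRectangular.

(** * Strict polynomial matrices and powers that vanish *)

Section StrictMatrices.
Local Open Scope ring_scope.
Variable F : fieldType.

(** The matrix Q sends the generator v_a to the sum of the v_b Q_ab(B).  The first
    condition says that this respects the relations v_a B^(lam a) = 0, the second
    one that the constant term of Q is strictly upper triangular. *)
Definition strict_mx l (lam : nat -> nat) (Q : 'M[{poly F}]_l) :=
  forall (a b : 'I_l) k, (Q a b)`_k != 0 ->
    (lam b <= lam a + k)%N && ((k == 0)%N ==> (a < b)%N).

(** The relations between generators whose strings have lengths [lam]. *)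
Definition torsion l (lam : nat -> nat) m (P : 'M[{poly F}]_(m, l)) :=
  forall i (a : 'I_l) k, (k < lam a)%N -> (P i a)`_k = 0.

Lemma strict_mxD l lam (P Q : 'M_l) :
  strict_mx lam P -> strict_mx lam Q -> strict_mx lam (P + Q).
Proof.
move=> sP sQ a b k; rewrite mxE coefD => nz.
have [p0|/sP//] := eqVneq (P a b)`_k 0; apply: sQ.
by move: nz; rewrite p0 add0r.
Qed.

Lemma strict_mxZ l lam (c : F) (Q : 'M_l) :
  strict_mx lam Q -> strict_mx lam (c%:P *: Q).
Proof.
move=> sQ a b k; rewrite mxE coefCM => nz; apply: sQ.
by apply: contraNneq nz => ->; rewrite mulr0.
Qed.

Lemma coef_mulmx_neq0 m l n (P : 'M[{poly F}]_(m, l)) (Q : 'M_(l, n)) i j k :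
  ((P *m Q) i j)`_k != 0 ->
  exists c k1 k2, [/\ (k1 + k2)%N = k, (P i c)`_k1 != 0 & (Q c j)`_k2 != 0].
Proof.
rewrite mxE coef_sum => nz.
have [c _] : exists2 c, true & (P i c * Q c j)`_k != 0.
  apply/exists_inP; apply: contraNT nz => /exists_inPn nz.
  by rewrite big1 // => c _; apply/eqP; rewrite -[_ == _]negbK nz.
rewrite coefM => {}nz.
have [k1 _] : exists2 k1 : 'I_k.+1, true & (P i c)`_k1 * (Q c j)`_(k - k1) != 0.
  apply/exists_inP; apply: contraNT nz => /exists_inPn nz.
  by rewrite big1 // => k1 _; apply/eqP; rewrite -[_ == _]negbK nz.
rewrite mulf_eq0 negb_or => /andP[nz1 nz2].
by exists c, k1, (k - k1)%N; split=> //; rewrite subnKC // -ltnS.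
Qed.

(** A nonzero coefficient of a product of matrices comes from a path along which
    all coefficients are nonzero; [k0] only shifts the starting cell. *)
Lemma strict_mx_chain l (lam : seq nat) (Q : 'M_l) e (a b : 'I_l) k k0 :
  strict_mx (nth 0%N lam) Q -> ((Q ^+ e) a b)`_k != 0 ->
  exists s, [/\ path (cell_step lam) (nat_of_ord a, k0) s, size s = e &
    last (nat_of_ord a, k0) s = (nat_of_ord b, (k0 + k)%N)].
Proof.
move=> sQ; elim: e a k k0 => [|e IHe] a k k0.
  rewrite expr0 mxE; have [->|_] := eqVneq a b; last by rewrite coef0 eqxx.
  by rewrite coef1; case: k => [|k]; rewrite ?eqxx // => _; exists [::]; rewrite addn0.
rewrite exprS => /coef_mulmx_neq0[c [k1 [k2 [<- /sQ/andP[/= lev cas] nz]]]].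
have [s [path_s size_s last_s]] := IHe c k2 (k0 + k1)%N nz.
exists ((nat_of_ord c, (k0 + k1)%N) :: s); split=> /=; last 1 first.
- by rewrite last_s addnA.
- by rewrite path_s andbT /cell_step /=; apply/and3P; split; move: cas; lia.
- by rewrite size_s.
Qed.

(** A nonzero coefficient of degree less than the length of its string would be the
    end of a path all of whose cells lie inside their strings, that is, of a chain
    with more than [max_chain lam] cells. *)
Lemma strict_mx_torsion (lam : seq nat) l (Q : 'M_l) :
  sorted geq lam -> all (leq 1) lam -> strict_mx (nth 0%N lam) Q ->
  torsion (nth 0%N lam) (Q ^+ max_chain lam).
Proof.
move=> srt pos sQ a b k kb; apply/eqP; apply: contraLR (leqnn (max_chain lam)).
move=> /(strict_mx_chain 0 sQ)[s [path_s size_s last_s]].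
rewrite -ltnNge -{1}size_s.
apply: (chain_size_le_max srt pos path_s).
have : ((last (nat_of_ord a, 0) s).2 < nth 0 lam (last (nat_of_ord a, 0) s).1)%N.
  by rewrite last_s.
elim: s (nat_of_ord a, 0%N) path_s {last_s size_s} => [|y s IHs] x /=.
  by move=> _ xv z; rewrite inE => /eqP ->.
case/andP=> /and3P[xy lev _] path_s /(IHs _ path_s) valid z.
by rewrite inE => /predU1P[->|/valid//]; have := valid y (mem_head _ _); lia.
Qed.

End StrictMatrices.

(** * Commuting nilpotent matrices of large rank and of large index *)

Section TwoCycles.
Local Open Scope ring_scope.
Variable F : fieldType.

(** Two cyclic walks, through the rows before h and through the rows from h on: a
    row goes to the next one, and the last row goes to B times the first one.  For
    h = 0 this is a single cycle. *)
Definition two_cycles l h : 'M[{poly F}]_l := \matrix_(a, b)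
  (((b == a.+1 :> nat) && (b != h :> nat))%:R +
   ((a.+1 == h :> nat) && (b == 0 :> nat)
    || (a.+1 == l :> nat) && (b == h :> nat))%:R * 'X).

Lemma two_cycles_strict l h (lam : nat -> nat) :
  (forall a b, (a <= b < l)%N -> (lam b <= lam a)%N) ->
  ((0 < h)%N -> (lam 0 <= (lam h.-1).+1)%N) -> (lam h <= (lam l.-1).+1)%N ->
  strict_mx lam (two_cycles l h).
Proof.
move=> anti lo hi a b k; rewrite mxE coefD coefMX.
case: k => [|[|k]] /=; last first.
- by rewrite -!polyC_natr !coefC /= addr0 eqxx.
- rewrite -!polyC_natr !coefC /= add0r.
  have [|_] := boolP (_ || _); last by rewrite eqxx.
  case/orP=> /andP[/eqP ea /eqP eb] _; rewrite andbT eb.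
    by rewrite (_ : nat_of_ord a = h.-1) ?addn1 ?lo; lia.
  by rewrite (_ : nat_of_ord a = l.-1) ?addn1 //; lia.
- rewrite -!polyC_natr !coefC /= addr0.
  have [|_] := boolP (_ && _); last by rewrite eqxx.
  case/andP=> /eqP eb _ _; rewrite addn0 eb ltnSn andbT anti //.
  by rewrite leqnSn -eb ltn_ord.
Qed.

Lemma cycle_power l (b : 'I_l.+1) x y : (y < l.+1)%N ->
  (two_cycles l.+1 0 ^+ (x * l.+1 + y)) ord0 b = (b == y :> nat)%:R * 'X^x.
Proof.
have step e z w : (w < l.+1)%N ->
    (forall c, (two_cycles l.+1 0 ^+ e) ord0 c = (c == w :> nat)%:R * 'X^z) ->
    forall c, (two_cycles l.+1 0 ^+ e.+1) ord0 c =
      'X^z * two_cycles l.+1 0 (inord w) c.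
  move=> wl He c; rewrite exprSr mxE (bigD1 (inord w)) //= He inordK // eqxx mul1r.
  rewrite big1 ?addr0 // => d; rewrite -val_eqE /= inordK // => /negbTE dw.
  by rewrite He dw !mul0r.
have row_next w c : (w < l.+1)%N -> two_cycles l.+1 0 (inord w) c =
    if (w.+1 < l.+1)%N then (c == w.+1 :> nat)%:R else (c == 0 :> nat)%:R * 'X.
  move=> wl; rewrite mxE inordK //= eqSS; have := ltn_ord c.
  case: (ltnP w.+1 l.+1) => [w1l|lw] cl.
    rewrite (_ : (w == l) && _ = false) ?mul0r ?addr0; last by lia.
    by rewrite (_ : _ && _ = (c == w.+1 :> nat)) //; lia.
  rewrite (_ : (w == l) && _ = (c == 0 :> nat)); last by lia.
  by rewrite (_ : _ && _ = false) ?add0r //; lia.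
elim: x y b => [|x IHx]; elim=> [|y IHy] b yl.
- by rewrite expr0 mxE mulr1 eq_sym.
- rewrite addnS (step _ 0%N y); [|lia|by move=> c; rewrite IHy //; lia].
  by rewrite row_next ?yl; [rewrite mul1r mulr1 | lia].
- rewrite addn0 mulSn addnC addnS (step _ x l) //; last first.
    by move=> c; rewrite IHx.
  by rewrite row_next // ltnn exprSr mulrCA.
- rewrite addnS (step _ x.+1 y); [|lia|by move=> c; rewrite IHy //; lia].
  by rewrite row_next ?yl; [rewrite mulrC | lia].
Qed.

End TwoCycles.

Section Perturbation.
Local Open Scope ring_scope.
Variables (F : fieldType) (l : nat) (X Y : 'M[{poly F}]_l).

(** The linear coefficient is named because it will be shown not to vanish, so
    that some value of the parameter keeps a given coefficient of the power from
    vanishing in any characteristic. *)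
Lemma exp_perturbation e : exists C : nat -> 'M[{poly F}]_l,
  (forall c : F, (X + c%:P *: Y) ^+ e = \sum_(i < e.+1) (c ^+ i)%:P *: C i)
  /\ C 1%N = \sum_(i < e) X ^+ i *m Y *m X ^+ (e - i.+1).
Proof.
suff [C [expC C1 C0 Cbig]] : exists C : nat -> 'M[{poly F}]_l,
  [/\ forall c : F, (X + c%:P *: Y) ^+ e = \sum_(i < e.+1) (c ^+ i)%:P *: C i,
      C 1%N = \sum_(i < e) X ^+ i *m Y *m X ^+ (e - i.+1),
      C 0%N = X ^+ e & C e.+1 = 0] by exists C.
elim: e => [|e [C [expC C1 C0 Cbig]]].
  exists (fun i => if i is 0 then 1 else 0); split=> //; last by rewrite big_ord0.
  by move=> c; rewrite big_ord1 expr0 scale1r.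
pose D i := C i *m X + (if i is j.+1 then C j *m Y else 0).
pose D' i := if (i < e.+2)%N then D i else 0.
exists D'; split.
- move=> c; rewrite exprSr expC -[LHS]/(_ *m _) mulmxDr.
  have -> : \sum_(i < e.+2) (c ^+ i)%:P *: D' i =
     \sum_(i < e.+2) (c ^+ i)%:P *: (C i *m X) +
     \sum_(i < e.+2) (c ^+ i)%:P *: (if i : nat is j.+1 then C j *m Y else 0).
    rewrite -big_split; apply: eq_bigr => i _.
    by rewrite /D' ltn_ord /D scalerDr.
  rewrite [Z in _ = Z + _]big_ord_recr /= Cbig mul0mx scaler0 addr0.
  rewrite [Z in _ = _ + Z]big_ord_recl /= scaler0 add0r.
  congr (_ + _); rewrite mulmx_suml; apply: eq_bigr => i _.
    by rewrite scalemxAl.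
  by rewrite /bump /= add1n exprS polyCM -scalemxAr -scalemxAl scalerA.
- rewrite /D' /D /= C1 C0 big_ord_recr /= subnn expr0 mulmx1 mulmx_suml.
  congr (_ + _); apply: eq_bigr => i _.
  by rewrite -mulmxA; congr (_ *m _); rewrite subSn // exprSr.
- by rewrite /D' /D /= C0 exprSr addr0.
- by rewrite /D' ltnn.
Qed.

End Perturbation.

Section LongWalk.
Local Open Scope ring_scope.
Variable F : closedFieldType.

Lemma exists_nonroot (p : {poly F}) : p != 0 -> exists c, p.[c] != 0.
Proof. by case/closed_nonrootP => c; exists c. Qed.

(** The e-th power of Q carries the first generator to a vector with a component
    at the bottom of a string, and so witnesses an index of at least e + 1. *)
Definition long_walk l (lam : nat -> nat) e := exists Q : 'M[{poly F}]_l,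
  strict_mx lam Q /\ exists a b : 'I_l,
    [/\ a = 0 :> nat, (0 < lam b)%N & ((Q ^+ e) a b)`_(lam b).-1 != 0].

Lemma long_walk_extend l l' lam e : long_walk l lam e -> long_walk (l + l') lam e.
Proof.
case=> Q [sQ [a [b [a0 b_gt0 nz]]]]; exists (block_mx Q 0 0 0); split.
  move=> i j k; rewrite !mxE; case: splitP => i' ->; rewrite mxE.
    case: splitP => j' ->; last by rewrite mxE coef0 eqxx.
    by move/sQ.
  by case: splitP => j' _; rewrite mxE coef0 eqxx.
exists (lshift l' a), (lshift l' b); split=> //=.
suff -> : block_mx Q 0 0 (0 : 'M_l') ^+ e = block_mx (Q ^+ e) 0 0 (0 ^+ e).
  by rewrite block_mxEul.
elim: e {nz} => [|e IHe]; first by rewrite !expr0 -scalar_mx_block.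
by rewrite !exprS IHe -[LHS]/(_ *m _) mulmx_block !(mulmx0, mul0mx, addr0, add0r) mul0r.
Qed.

(** Put m strings of length q before shorter ones.  X walks down the tops of the
    new strings and then follows the given walk; Y leads from the bottom where
    that walk ends to the first new bottom.  In the linear coefficient of
    (X + c Y)^(e + 2 m), the entry from the first new top to the last new bottom
    has a single contribution: m steps of X down the new tops and into the given
    walk, e steps along it, one step of Y, and m - 1 steps along the new bottoms. *)
Lemma long_walk_step l m q lam mu e :
  long_walk l mu e -> (0 < m)%N -> (forall a, (a < l)%N -> (mu a < q)%N) ->
  (forall a, (a < m)%N -> lam a = q) -> (forall a, (a < l)%N -> lam (m + a)%N = mu a) ->
  long_walk (m + l) lam (e + m.*2).
Proof.
case: m => // m [Q [sQ [a0 [b0 [a00 b_gt0 nz]]]]] _ mu_lt lam_q lam_mu.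
pose N : 'M[{poly F}]_m.+1 := \matrix_(a, b) (b == a.+1 :> nat)%:R.
pose psi : 'M[{poly F}]_(m.+1, l) := delta_mx ord_max a0.
pose X := block_mx N psi 0 Q.
pose d := (q - mu b0)%N.
pose Y : 'M[{poly F}]_(m.+1 + l) := 'X^d *: delta_mx (rshift _ b0) (lshift _ ord0).
have sX : strict_mx lam X.
  move=> i j k; rewrite !mxE; case: splitP => i' iE; rewrite mxE; case: splitP => j' jE.
  - rewrite mxE -polyC_natr coefC; case: k => [|k] /=; last by case/eqP.
    have [E _|_ /eqP//] := eqVneq (nat_of_ord j') i'.+1.
    by rewrite iE jE !lam_q //= E ltnSn addn0 leqnn.
  - rewrite mxE -polyC_natr coefC; case: k => [|k] /=; last by case/eqP.
    case: (_ && _) => [_|/eqP//].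
    rewrite iE jE lam_mu // lam_q // addn0 ltnW ?mu_lt //=.
    by have := ltn_ord i'; lia.
  - by rewrite mxE coef0 eqxx.
  - by move/sQ; rewrite iE jE !lam_mu // ltn_add2l.
have sY : strict_mx lam Y.
  move=> i j k; rewrite !mxE coefXnM.
  have [->|] := eqVneq i (rshift _ b0); last by rewrite coef0 if_same eqxx.
  have [->|] := eqVneq j (lshift _ ord0); last by rewrite coef0 if_same eqxx.
  rewrite coef1 /=; case: ltnP; rewrite ?eqxx // => dk.
  case: eqP; rewrite ?eqxx // => kd _.
  by rewrite lam_q // lam_mu //; have := mu_lt b0 (ltn_ord _); rewrite /d in dk kd; lia.
have top j c : (j < m.+1)%N -> (X ^+ j) (lshift l ord0) c = (c == j :> nat)%:R.
  elim: j c => [|j IHj] c jm; first by rewrite expr0 mxE -val_eqE eq_sym.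
  rewrite exprSr mxE (bigD1 (lshift l (inord j))) //= IHj; last by lia.
  rewrite /= inordK ?eqxx ?mul1r ?big1 ?addr0; try lia.
    rewrite !mxE; case: splitP => i /= iE; last by move: iE; rewrite inordK; lia.
    rewrite mxE.
    case: splitP => c' cE; rewrite !mxE; first by rewrite -iE cE inordK //; lia.
    rewrite cE -val_eqE /= -iE inordK; last by lia.
    rewrite (_ : (j == m) = false) /=; last by lia.
    by rewrite (_ : (_ == j.+1) = false) //; lia.
  move=> i; rewrite -val_eqE /= IHj; last by lia.
  by rewrite inordK; [move=> /negbTE ->; rewrite mul0r|lia].
have bot j : row (lshift l ord0) (X ^+ (m.+1 + j)) = row_mx 0 (row a0 (Q ^+ j)).
  elim: j => [|j IHj].
    have topm : row (lshift l ord0) (X ^+ m) = row_mx (delta_mx 0 ord_max) 0.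
      apply/rowP => c; rewrite !mxE top //.
      case: splitP => c' cE; rewrite mxE cE -?val_eqE //=.
      by case: eqP => //; lia.
    rewrite addn0 exprSr row_mul topm mul_row_block !mul0mx !addr0 -!rowE.
    congr row_mx; apply/rowP => c; rewrite !mxE ?eqxx /=.
      by case: eqP => // cE; have := ltn_ord c; lia.
    by rewrite eq_sym.
  rewrite addnS exprSr row_mul IHj mul_row_block [Q ^+ _.+1]exprSr row_mul.
  by rewrite !(mul0mx, mulmx0, add0r, addr0).
(* With m + 1 new strings, X leaves their tops for good after m + 1 steps. *)
have last_top r : (X ^+ r) (lshift l ord0) (lshift l ord_max) = (r == m)%:R.
  have [rm|mr] := ltnP r m.+1; first by rewrite top // eq_sym.
  have /rowP/(_ (lshift l ord_max)) := bot (r - m.+1)%N.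
  by rewrite subnKC // row_mxEl !mxE => ->; rewrite (_ : (r == m) = false) //; lia.
have [C [expC C1]] := exp_perturbation X Y (e + m.+1.*2).
pose coef_of (M : 'M[{poly F}]_(m.+1 + l)) := (M (lshift l ord0) (lshift l ord_max))`_q.-1.
pose g := \poly_(i < (e + m.+1.*2).+1) coef_of (C i).
have gE c : coef_of ((X + c%:P *: Y) ^+ (e + m.+1.*2)) = g.[c].
  rewrite expC horner_poly /coef_of summxE coef_sum; apply: eq_bigr => i _.
  by rewrite mxE coefCM mulrC.
have g1 : g`_1 != 0.
  (* Y must be applied after exactly e + m + 1 steps of X, leaving m steps of X. *)
  have i1P : (e + m.+1 < e + m.+1.*2)%N by lia.
  rewrite coef_poly ltnS (leq_ltn_trans _ i1P) // /coef_of C1 summxE coef_sum.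
  have termE i r : ((X ^+ i *m Y *m X ^+ r) (lshift l ord0) (lshift l ord_max))`_q.-1
      = ((r == m)%:R * ('X^d * (X ^+ i) (lshift l ord0) (rshift m.+1 b0)))`_q.-1.
    congr (_`_ _); rewrite /Y -scalemxAr -scalemxAl mxE -(mul_delta_mx (0 : 'I_1)).
    rewrite (mulmxA (X ^+ i)) -(mulmxA _ _ (X ^+ r)) -colE -rowE mxE big_ord1 !mxE.
    by rewrite last_top mulrC -mulrA mulrC -mulrA.
  rewrite (bigD1 (Ordinal i1P)) //= termE big1 ?addr0 => [|i].
    rewrite (_ : _ == m) ?mul1r; last by lia.
    have /rowP/(_ (rshift m.+1 b0)) := bot e; rewrite row_mxEr !mxE.
    rewrite [(e + m.+1)%N]addnC => ->; rewrite coefXnM.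
    have mu_q := mu_lt b0 (ltn_ord b0); have -> : (q.-1 < d)%N = false by rewrite /d; lia.
    by rewrite (_ : (q.-1 - d)%N = (mu b0).-1) // /d; lia.
  rewrite -val_eqE /= => ni; rewrite termE (_ : _ == m = false) ?mul0r ?coef0 //.
  by have := ltn_ord i; lia.
have [c] : exists c, g.[c] != 0.
  by apply: exists_nonroot; apply: contraNneq g1 => ->; rewrite coef0.
rewrite -gE => nzc; exists (X + c%:P *: Y); split.
  by apply: strict_mxD => //; apply: strict_mxZ.
exists (lshift l ord0), (lshift l ord_max); split=> //; rewrite lam_q //.
by have := mu_lt b0 (ltn_ord b0); lia.
Qed.

(** A cycle through the strings of lengths p and p - 1 visits every basis vector,
    and ends at the bottom of the last string of length p. *)
Lemma long_walk_cycle l m p lam : (0 < m <= l)%N -> (0 < p)%N ->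
  (forall a, (a < m)%N -> lam a = p) ->
  (forall a, (m <= a < l)%N -> lam a = p.-1) ->
  long_walk l lam (p.-1 * l + m.-1).
Proof.
case: l => [|l] ml p_gt0 lam_p lam_p1; first by lia.
exists (two_cycles F l.+1 0); split.
  have val a : (a < l.+1)%N -> lam a = if (a < m)%N then p else p.-1.
    by move=> al; case: ltnP => am; [apply: lam_p | apply: lam_p1; lia].
  apply: two_cycles_strict => //= [a b ab|].
    by rewrite !val; try lia; do 2?case: ifP; lia.
  by rewrite !val //; do 2?case: ifP; lia.
exists ord0, (inord m.-1); rewrite inordK; last by lia.
rewrite lam_p; last by lia.
split=> //; rewrite cycle_power; last by lia.
by rewrite inordK ?eqxx ?mul1r ?coefXn ?eqxx ?oner_eq0 //; lia.
Qed.

End LongWalk.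

Section UChain.
Local Open Scope ring_scope.
Variables (F : closedFieldType) (lam : seq nat).
Hypothesis lam_sorted : sorted geq lam.
Hypothesis lam_gt0 : all (leq 1) lam.
Notation N := (parts_ge lam).
Notation part0 := (nth 0%N lam).

(** Start with the strings of lengths p and p - 1, add the longer strings one
    length at a time, and let the shorter strings be mapped to zero. *)
Lemma long_walk_uchain p : p \in lam -> long_walk F (size lam) part0 (uchain lam p).-1.
Proof.
move=> lam_p; have p_gt0 : (0 < p)%N := allP lam_gt0 _ lam_p.
have anti q q' := @parts_ge_anti lam q q'.
have lt_Np : (N p.+1 < N p)%N.
  have := nth_index 0%N lam_p => pE.
  have := @ltn_parts_ge lam lam_sorted (index p lam) p.+1 isT.
  have := @ltn_parts_ge lam lam_sorted (index p lam) p p_gt0.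
  by rewrite pE; lia.
pose len := (N p.-1 - N p.+1)%N; pose e0 := (p.-1 * len + (N p - N p.+1).-1)%N.
(* The rows from [N (p + j).+1] on are those of length at most p + j. *)
have walk j : long_walk F (N p.-1 - N (p + j).+1) (fun a => part0 (N (p + j).+1 + a)%N)
    (e0 + (N p.+1 - N (p + j).+1).*2).
  elim: j => [|j IHj].
    rewrite addn0 subnn double0 addn0.
    apply: (@long_walk_cycle _ _ (N p - N p.+1) p) => //.
    - by have := anti p.-1 p ltac:(lia); lia.
    - by move=> a am; apply: (nth_level lam_sorted) => //; lia.
    - move=> a am; have [p1|p1] := posnP p.-1; last first.
        by apply: (nth_level lam_sorted) => //; rewrite (ltn_predK p_gt0); lia.
      by move: am; rewrite p1 (_ : p = 1%N) ?(parts_ge0 lam_gt0); lia.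
  rewrite addnS; set q := (p + j).+1 in IHj *.
  have le1 := anti q q.+1 ltac:(lia); have le2 := anti p.+1 q ltac:(lia).
  have le3 := anti p.-1 p.+1 ltac:(lia).
  have [m0|m_gt0] := posnP (N q - N q.+1)%N.
    by have <- : N q = N q.+1 by lia.
  rewrite (_ : (N p.-1 - N q.+1)%N = (N q - N q.+1 + (N p.-1 - N q))%N); last by lia.
  rewrite (_ : (e0 + _)%N = (e0 + (N p.+1 - N q).*2 + (N q - N q.+1).*2)%N); last by lia.
  apply: (long_walk_step (q := q) IHj m_gt0).
  - move=> a al; rewrite ltnNge -ltn_parts_ge //. lia.
  - by move=> a al; apply: (nth_level lam_sorted) => //; lia.
  - by move=> a al; congr nth; lia.
(* At level p + head lam all longer strings have been added. *)
have N_big : N (p + head 0%N lam).+1 = 0%N.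
  have := @ltn_parts_ge lam lam_sorted 0 (p + head 0%N lam).+1 isT.
  by rewrite nth0; lia.
have := walk (head 0%N lam); rewrite N_big !subn0.
move=> /(@long_walk_extend _ _ (size lam - N p.-1)).
rewrite subnKC; last by apply: count_size.
rewrite (_ : (e0 + _)%N = (uchain lam p).-1).
  by rewrite /long_walk /strict_mx => -[Q sQ]; exists Q.
by rewrite uchainE // /e0 /len; move: (p.-1 * _)%N => c; lia.
Qed.

End UChain.

(** * Jordan generators as a presentation over the polynomial ring *)

Section Evaluation.
Local Open Scope ring_scope.
Variables (F : fieldType) (n' : nat).
Notation n := n'.+1.
Variable B : 'M[F]_n.

(** Each row of P gives coordinates with respect to the generators in the rows of
    v, for the module structure in which the variable acts as B on the right. *)
Definition eval_mx l (v : 'M[F]_(l, n)) m (P : 'M[{poly F}]_(m, l)) : 'M[F]_(m, n) :=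
  \matrix_(i < m) \sum_a row a v *m horner_mx B (P i a).

Lemma row_eval_mx l (v : 'M_(l, n)) m (P : 'M_(m, l)) i :
  row i (eval_mx v P) = \sum_a row a v *m horner_mx B (P i a).
Proof. exact: rowK. Qed.

(** The rows of [eval_mx v Q] are a family of vectors like v.  When they are the
    images of the generators under a matrix commuting with B, multiplication by Q
    represents that matrix, see [eval_mx_act]. *)
Lemma eval_mxM l (v : 'M_(l, n)) k (Q : 'M_(k, l)) m (P : 'M_(m, k)) :
  eval_mx v (P *m Q) = eval_mx (eval_mx v Q) P.
Proof.
apply/row_matrixP => i; rewrite !row_eval_mx.
under [RHS]eq_bigr => c _ do rewrite row_eval_mx mulmx_suml.
rewrite exchange_big; apply: eq_bigr => a _ /=.
rewrite mxE rmorph_sum mulmx_sumr; apply: eq_bigr => c _.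
by rewrite mulrC rmorphM mulmxA.
Qed.

Lemma eval_mx_poly_const l (v : 'M_(l, n)) m (G : 'M[F]_(m, l)) :
  eval_mx v (map_mx polyC G) = G *m v.
Proof.
apply/row_matrixP => i; rewrite row_eval_mx row_mul mulmx_sum_row.
by apply: eq_bigr => a _; rewrite !mxE horner_mx_C mul_mx_scalar.
Qed.

Lemma eval_mx1 l (v : 'M_(l, n)) : eval_mx v 1%:M = v.
Proof. by rewrite -(map_mx1 polyC) eval_mx_poly_const mul1mx. Qed.

Lemma eval_mx_comm l (v : 'M_(l, n)) m (P : 'M_(m, l)) (A : 'M_n) :
  comm_mx A B -> eval_mx (v *m A) P = eval_mx v P *m A.
Proof.
move=> AB; apply/row_matrixP => i; rewrite row_mul !row_eval_mx mulmx_suml.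
apply: eq_bigr => a _; rewrite row_mul -!mulmxA; congr (_ *m _).
exact: comm_mx_horner.
Qed.

Lemma eval_mx_scalar l (v : 'M_(l, n)) p : eval_mx v p%:M = v *m horner_mx B p.
Proof.
apply/row_matrixP => i; rewrite row_eval_mx (bigD1 i) //= !mxE eqxx mulr1n.
rewrite row_mul big1 ?addr0 // => a /negbTE ai.
by rewrite mxE eq_sym ai mulr0n rmorph0 mulmx0.
Qed.

Lemma eval_mx_sum l (v : 'M_(l, n)) m k (P : 'I_k -> 'M_(m, l)) :
  eval_mx v (\sum_i P i) = \sum_i eval_mx v (P i).
Proof.
apply/row_matrixP => j; rewrite linear_sum /= row_eval_mx.
under [RHS]eq_bigr => i _ do rewrite row_eval_mx.
rewrite exchange_big; apply: eq_bigr => a _ /=.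
by rewrite summxE rmorph_sum mulmx_sumr.
Qed.

Lemma horner_mx_truncate (u : 'rV_n) d (p : {poly F}) :
  u *m B ^+ d = 0 -> u *m horner_mx B p = \sum_(k < d) p`_k *: (u *m B ^+ k).
Proof.
move=> ud; rewrite -{1}(poly_take_drop d p) [_ * 'X^d]mulrC rmorphD rmorphM /=.
rewrite rmorphXn /= horner_mx_X mulmxDr mulmxA ud mul0mx addr0.
rewrite /take_poly poly_def rmorph_sum mulmx_sumr.
by apply: eq_bigr => k _; rewrite /= linearZ rmorphXn /= horner_mx_X scalemxAr.
Qed.

End Evaluation.

Section JordanGenerators.
Local Open Scope ring_scope.
Variables (F : fieldType) (n' : nat).
Notation n := n'.+1.
Implicit Types (A B : 'M[F]_n) (lam : seq nat).

(** A presentation of F^n: as the dimensions add up, the relations in the first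
    clause generate all others, see [jordan_generators_torsion]. *)
Definition jordan_generators lam B (v : 'M[F]_(size lam, n)) :=
  [/\ forall a, row a v *m B ^+ nth 0%N lam a = 0,
      exists S, eval_mx B v S = 1%:M
    & (\sum_(i < size lam) nth 0%N lam i)%N = n].

Definition jordan_strings lam B (v : 'M[F]_(size lam, n)) :=
  \mxcol_(i < size lam) \matrix_(k < nth 0%N lam i) (row i v *m B ^+ k).

Definition string_coefs lam m (P : 'M[{poly F}]_(m, size lam)) :=
  \mxrow_(i < size lam) \matrix_(j < m, k < nth 0%N lam i) (P j i)`_k.

Lemma eval_mx_strings lam B v m (P : 'M_(m, size lam)) :
  (forall a, row a v *m B ^+ nth 0%N lam a = 0) ->
  eval_mx B v P = string_coefs P *m jordan_strings B v.
Proof.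
move=> vB; rewrite mul_mxrow_mxcol; apply/row_matrixP => j.
rewrite row_eval_mx linear_sum; apply: eq_bigr => a _ /=.
rewrite (horner_mx_truncate _ (vB a)) row_mul mulmx_sum_row.
by apply: eq_bigr => k _; rewrite !mxE rowK.
Qed.

Lemma jordan_strings_free lam B v :
  jordan_generators B v -> row_free (jordan_strings (lam := lam) B v).
Proof.
case=> vB [S evS] sum_lam; rewrite /row_free eqn_leq rank_leq_row /=.
rewrite {1}sum_lam; apply: leq_trans (_ : \rank (1%:M : 'M[F]_n) <= _)%N.
  by rewrite mxrank1.
by rewrite -evS eval_mx_strings // mxrankM_maxr.
Qed.

Lemma jordan_generators_torsion lam B v m (P : 'M_(m, size lam)) :
  jordan_generators B v -> (eval_mx B v P = 0 <-> torsion (nth 0%N lam) P).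
Proof.
move=> gen_v; have free := jordan_strings_free gen_v; have [vB _ _] := gen_v.
rewrite eval_mx_strings //; split=> [PW|tP].
  have /mxrowP c0 : string_coefs P = 0 by apply: (row_free_inj free); rewrite mul0mx.
  move=> i a k ka; have := c0 a; rewrite mxrowK => /matrixP/(_ i (Ordinal ka)).
  by rewrite !mxE.
suff -> : string_coefs P = 0 by rewrite mul0mx.
by apply/mxrowP => a; rewrite mxrowK; apply/matrixP => i k; rewrite !mxE tP.
Qed.

End JordanGenerators.

Section JordanPartition.
Local Open Scope ring_scope.
Variable F : fieldType.

Lemma jordan_partitionP n lam (A : 'M[F]_n) : jordan_partition lam A <->
  is_partition n lam /\ exists W : 'M[F]_(_, n), [/\ (\sum_(i < size lam) nth 0%N lam i)%N = n,
    row_free W & W *m A = nilpotent_jordan_mx F lam *m W].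
Proof.
split=> [[part [e]]|[part [W [e]]]].
  case: n / e A part => A part; rewrite castmx_id => -[P uP /(similarP uP) PA].
  by split=> //; exists P; rewrite row_free_unit.
case: n / e A W part => A W part; rewrite row_free_unit => uW WA.
by split=> //; exists erefl; rewrite castmx_id; exists W => //; apply/similarP.
Qed.

Lemma row_jordan_block m n (M : 'M[F]_(m, n)) (k : 'I_m) :
  row k (nilpotent_jordan_block F m *m M) =
  if insub k.+1 is Some k' then row k' M else 0.
Proof.
rewrite row_mul mulmx_sum_row; case: insubP => [k' _ k'E|km].
  rewrite (bigD1 k') //= !mxE k'E eqxx scale1r big1 ?addr0 // => j.
  rewrite -val_eqE /= k'E eq_sym => /negbTE jk.
  by rewrite !mxE jk scale0r.
rewrite big1 // => j _; rewrite !mxE; case: eqP => [kj|_]; last by rewrite scale0r.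
by rewrite kj ltn_ord in km.
Qed.

(** The first row of each Jordan block in the transition matrix is a generator. *)
Lemma jordan_partition_generators n' lam (A : 'M[F]_n'.+1) :
  jordan_partition lam A -> exists v, jordan_generators (lam := lam) A v.
Proof.
case/jordan_partitionP => [[_ /allP pos _] [W [sum_lam free_W WA]]].
have {}pos (i : 'I_(size lam)) : (0 < nth 0%N lam i)%N by apply/pos/mem_nth.
pose W_ i := submxcol W i.
have W_A i : W_ i *m A = nilpotent_jordan_block F _ *m W_ i.
  move: WA; rewrite -{1 2}[W]submxcolK mxcol_mul mul_mxdiag_mxcol.
  by move/eq_mxcolP/(_ i).
have W_row (i : 'I_(size lam)) k (ki : (k < nth 0%N lam i)%N) :
    row (Ordinal ki) (W_ i) = row (Ordinal (pos i)) (W_ i) *m A ^+ k.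
  elim: k ki => [|k IHk] ki; first by rewrite expr0 mulmx1; congr row; apply: val_inj.
  rewrite exprSr -[_ * _]/(_ *m _) mulmxA -(IHk (ltnW ki)) -row_mul W_A row_jordan_block.
  by rewrite insubT.
pose v : 'M_(size lam, n'.+1) := \matrix_i row (Ordinal (pos i)) (W_ i).
have vA a : row a v *m A ^+ nth 0%N lam a = 0.
  have lk : ((nth 0%N lam a).-1 < nth 0%N lam a)%N by rewrite prednK.
  have -> : A ^+ nth 0%N lam a = A ^+ (nth 0%N lam a).-1 *m A.
    by rewrite -[_ *m _]/(_ * _) -exprSr prednK.
  rewrite rowK mulmxA -(W_row a _ lk) -row_mul W_A row_jordan_block insubF //=.
  by rewrite prednK ?ltnn.
have strings_W : jordan_strings A v = W.
  apply/mxcolP => i; rewrite mxcolK; apply/row_matrixP => k.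
  by rewrite !rowK -W_row; congr row; apply: val_inj.
have full_W : row_full W by rewrite /row_full (eqP free_W) sum_lam.
pose C := pinvmx W.
pose S : 'M[{poly F}]_(n'.+1, size lam) := \matrix_(j, i)
  \poly_(k < nth 0%N lam i) (if insub k is Some k' then submxrow C i j k' else 0).
exists v; split=> //; exists S; rewrite eval_mx_strings // strings_W.
suff -> : string_coefs S = C by rewrite mulVpmx.
apply/mxrowP => i; rewrite mxrowK; apply/matrixP => j k.
by rewrite [LHS]mxE mxE coef_poly ltn_ord valK.
Qed.

Lemma generators_jordan_partition n' lam (A : 'M[F]_n'.+1) v :
  is_partition n'.+1 lam -> jordan_generators (lam := lam) A v -> jordan_partition lam A.
Proof.
move=> part gen_v; apply/jordan_partitionP; split=> //.
have [vA _ sum_lam] := gen_v; exists (jordan_strings A v); split=> //.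
  exact: jordan_strings_free.
rewrite mxcol_mul mul_mxdiag_mxcol; apply: eq_mxcol => i.
apply/row_matrixP => k; rewrite row_jordan_block row_mul rowK.
rewrite -mulmxA -[_ *m A]/(_ * _) -exprSr.
case: insubP => [k' _ k'E|]; first by rewrite rowK k'E.
rewrite -leqNgt => lek; have -> : k.+1 = nth 0%N lam i.
  by apply/eqP; rewrite eqn_leq lek ltn_ord.
exact: vA.
Qed.

End JordanPartition.

(** * Generators adapted to a commuting nilpotent matrix *)

Section Triangularization.
Local Open Scope ring_scope.
Variable F : fieldType.

(** Block triangular matrices, for the grouping of the indices by the value of f. *)
Definition respects l (f : 'I_l -> nat) (M : 'M[F]_l) :=
  forall a b, M a b != 0 -> (f b <= f a)%N.

Definition strictly_upper l (M : 'M[F]_l) := forall a b, M a b != 0 -> (a < b)%N.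

Lemma respects1 l (f : 'I_l -> nat) : respects f 1%:M.
Proof. by move=> a b; rewrite mxE; have [->|] := eqVneq a b; rewrite ?eqxx. Qed.

Lemma respectsM l (f : 'I_l -> nat) M N :
  respects f M -> respects f N -> respects f (M *m N).
Proof.
move=> fM fN a b; rewrite mxE => nz.
have [c] : exists c, M a c * N c b != 0.
  apply/existsP; apply: contraNT nz => /existsPn nz.
  by rewrite big1 // => c _; apply/eqP; rewrite -[_ == _]negbK nz.
by rewrite mulf_eq0 negb_or => /andP[/fM + /fN]; move=> ? /leq_trans; apply.
Qed.

Lemma respectsX l (f : 'I_l -> nat) M k : respects f M -> respects f (M ^+ k).
Proof.
move=> fM; elim: k => [|k IHk]; first exact: respects1.
by rewrite exprS; apply: respectsM.
Qed.

Definition triangularizable l (f : 'I_l -> nat) (M : 'M[F]_l) := exists G H,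
  [/\ G *m H = 1%:M, respects f G, respects f H & strictly_upper (G *m M *m H)].

Lemma triangularizable_conj l (f : 'I_l -> nat) G H M :
  G *m H = 1%:M -> respects f G -> respects f H ->
  triangularizable f (G *m M *m H) -> triangularizable f M.
Proof.
move=> GH fG fH [G' [H' [GH' fG' fH' su]]].
exists (G' *m G), (H *m H'); split; try exact: respectsM.
  by rewrite mulmxA -(mulmxA G') GH mulmx1.
by move: su; rewrite !mulmxA.
Qed.

Lemma conj_nilpotent l (G H M : 'M[F]_l) k :
  G *m H = 1%:M -> M ^+ k = 0 -> (G *m M *m H) ^+ k = 0.
Proof.
move=> GH Mk; have HG := mulmx1C GH.
suff -> : (G *m M *m H) ^+ k = G *m M ^+ k *m H by rewrite Mk mulmx0 mul0mx.
elim: k {Mk} => [|k IHk]; first by rewrite !expr0 mulmx1.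
by rewrite !exprS IHk -[LHS]/(_ *m _) !mulmxA -[_ *m H *m G]mulmxA HG mulmx1.
Qed.

(** The first column of each power of M is supported on the indices with the
    largest value of f, as f decreases.  The last nonzero one among these columns
    is killed by M; with it as first basis vector, M induces a nilpotent matrix on
    the quotient. *)
Lemma nilpotent_triangularizable_step l (f : 'I_(1 + l) -> nat) (M : 'M[F]_(1 + l)) k :
  (forall (f' : 'I_l -> nat) M', (forall a b : 'I_l, (a <= b)%N -> (f' b <= f' a)%N) ->
    respects f' M' -> M' ^+ k = 0 -> triangularizable f' M') ->
  (forall a b : 'I_(1 + l), (a <= b)%N -> (f b <= f a)%N) ->
  respects f M -> M ^+ k = 0 -> triangularizable f M.
Proof.
move=> IHl f_anti fM Mk; pose a0 : 'I_(1 + l) := lshift l ord0.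
(* A permutation that respects f brings a nonzero entry of the column to the top. *)
wlog [y y0 [My f_y]] : M fM Mk / exists2 y : 'cV[F]_(1 + l), y a0 0 != 0 &
    M *m y = 0 /\ forall a, y a 0 != 0 -> (f a0 <= f a)%N.
  move=> wlog_y.
  have exk : exists j, col a0 (M ^+ j) == 0 by exists k; rewrite Mk linear0.
  case: (ex_minnP exk) => -[|j] /eqP Mj j_min.
    by move/colP/(_ a0): Mj; rewrite !mxE eqxx => /eqP; rewrite oner_eq0.
  pose y := col a0 (M ^+ j).
  have My : M *m y = 0 by rewrite /y colE mulmxA -[M *m _]/(M * _) -exprS -colE.
  have fy a : y a 0 != 0 -> (f a0 <= f a)%N.
    by rewrite mxE; apply: respectsX.
  have [c yc] : exists c, y c 0 != 0.
    apply/existsP; apply: contraT => /existsPn y0.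
    have /eqP/j_min : y = 0 by apply/colP => c; rewrite [RHS]mxE; apply/eqP; rewrite -[_ == _]negbK.
    by rewrite ltnn.
  pose P : 'M[F]_(1 + l) := tperm_mx a0 c.
  have PP : P *m P = 1%:M by rewrite -perm_mxM tperm2 perm_mx1.
  have f0c : f c = f a0 by apply/eqP; rewrite eqn_leq f_anti // fy.
  have f_tperm a : f (tperm a0 c a) = f a by case: tpermP => // ->.
  have fP : respects f P.
    move=> a b; rewrite !mxE; have [<-|] := eqVneq (tperm a0 c a) b; last by rewrite ?eqxx.
    by rewrite f_tperm.
  apply: (triangularizable_conj PP fP fP); apply: wlog_y.
  - by do 2?[apply: respectsM => //].
  - exact: conj_nilpotent.
  exists (P *m y); first by rewrite -row_permE mxE tpermL.
  split; first by rewrite mulmxA -(mulmxA _ P P) PP mulmx1 -mulmxA My mulmx0.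
  by move=> a; rewrite -row_permE mxE => /fy; rewrite f_tperm.
have y_unit : usubmx y = (y a0 0)%:M.
  by apply/matrixP => i j; rewrite !ord1 !mxE eqxx mulr1n.
pose c := y a0 0; pose y' : 'cV[F]_l := dsubmx y.
(* L is the identity with y as first column; Lm also contains its inverse. *)
pose Lm d e : 'M[F]_(1 + l) := block_mx d%:M 0 (e *: y') 1%:M.
have LmM d e d' e' : Lm d e *m Lm d' e' = Lm (d * d') (d' * e + e').
  rewrite mulmx_block !(mulmx0, mul0mx, addr0, add0r, mulmx1, mul1mx).
  by rewrite -scalar_mxM mul_mx_scalar scalerA -scalerDl.
have Lm1 : Lm 1 0 = 1%:M by rewrite /Lm scale0r -scalar_mx_block.
have f_y' i : y' i 0 != 0 -> (f a0 <= f (rshift 1 i))%N by rewrite mxE; apply: f_y.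
have f_l0 (i : 'I_1) : f (lshift l i) = f a0 by rewrite ord1.
have fL d e : respects f (Lm d e).
  move=> a b; case: (@split_ordP 1 l a) => i ->; case: (@split_ordP 1 l b) => j ->.
  - by rewrite !f_l0.
  - by rewrite /Lm block_mxEur mxE eqxx.
  - rewrite /Lm block_mxEdl mxE f_l0 ord1 => nz; apply: f_y'.
    by apply: contraNneq nz => ->; rewrite mulr0.
  - by rewrite /Lm block_mxEdr mxE; have [->|] := eqVneq i j; rewrite ?eqxx.
pose L := Lm c 1; pose Li := Lm c^-1 (- c^-1).
have LiL : Li *m L = 1%:M by rewrite LmM mulVf // mulrN divff // addNr.
apply: (triangularizable_conj LiL (fL _ _) (fL _ _)).
pose M1 := Li *m M *m L; rewrite -/M1.
have M1k : M1 ^+ k = 0 by apply: conj_nilpotent.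
have fM1 : respects f M1 by apply: respectsM (fL _ _); apply: respectsM fM; apply: fL.
have [r [M' M1E]] : exists r M', M1 = block_mx 0 r 0 M'.
  exists (usubmx (rsubmx M1)), (dsubmx (rsubmx M1)).
  have L_first : L *m col_mx 1%:M 0 = y.
    rewrite mul_block_col !(mulmx0, mulmx1, addr0, mul0mx) scale1r.
    by rewrite -y_unit vsubmxK.
  have M1_first : lsubmx M1 = 0.
    have : M1 *m col_mx 1%:M 0 = 0 by rewrite /M1 -mulmxA L_first -mulmxA My mulmx0.
    by rewrite -{1}[M1]hsubmxK mul_row_col mulmx1 mulmx0 addr0.
  by rewrite block_mxEh vsubmxK col_mx0 -{1}[M1]hsubmxK M1_first.
have M'k : M' ^+ k = 0.
  have [r' M1k'] : exists r', M1 ^+ k = block_mx (0 ^+ k) r' 0 (M' ^+ k).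
    rewrite M1E; elim: k {Mk M1k IHl} => [|j [r' IHj]].
      by exists 0; rewrite !expr0 -scalar_mx_block.
    exists (0 ^+ j *m r + r' *m M').
    rewrite !exprSr IHj -[LHS]/(_ *m _) mulmx_block.
    by rewrite !(mulmx0, mul0mx, addr0, add0r) mulr0.
  by have := congr1 drsubmx M1k'; rewrite block_mxKdr M1k => <-; apply/matrixP => i j; rewrite !mxE.
pose f' (a : 'I_l) := f (rshift 1 a).
have f'_anti (a b : 'I_l) : (a <= b)%N -> (f' b <= f' a)%N by move=> ab; apply: f_anti.
have fM' : respects f' M'.
  by move=> a b nz; apply: fM1; rewrite M1E block_mxEdr.
have [G' [H' [GH' fG' fH' su]]] := IHl f' M' f'_anti fM' M'k.
have f_block N : respects f' N -> respects f (block_mx 1%:M 0 0 N : 'M_(1 + l)).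
  move=> fN a b; case: (@split_ordP 1 l a) => i ->; case: (@split_ordP 1 l b) => j ->.
  - by rewrite !f_l0.
  - by rewrite block_mxEur mxE eqxx.
  - by rewrite block_mxEdl mxE eqxx.
  - by rewrite block_mxEdr => /fN.
exists (block_mx 1%:M 0 0 G'), (block_mx 1%:M 0 0 H'); split; try exact: f_block.
  rewrite mulmx_block !(mulmx0, mul0mx, addr0, add0r, mulmx1, mul1mx) GH'.
  by rewrite -scalar_mx_block.
rewrite M1E !mulmx_block !(mulmx0, mul0mx, addr0, add0r, mulmx1, mul1mx).
move=> a b; case: (@split_ordP 1 l a) => i ->; case: (@split_ordP 1 l b) => j ->.
- by rewrite block_mxEul mxE eqxx.
- by rewrite ord1.
- by rewrite block_mxEdl mxE eqxx.
- by rewrite block_mxEdr => /su.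
Qed.

Lemma nilpotent_triangularizable l (f : 'I_l -> nat) (M : 'M[F]_l) k :
  (forall a b : 'I_l, (a <= b)%N -> (f b <= f a)%N) ->
  respects f M -> M ^+ k = 0 -> triangularizable f M.
Proof.
elim: l f M => [|l IHl] f M.
  by exists 1%:M, 1%:M; split; try exact: respects1; [rewrite mulmx1 | case].
exact: (@nilpotent_triangularizable_step l).
Qed.

End Triangularization.

Section Representation.
Local Open Scope ring_scope.
Variables (F : fieldType) (n' : nat).
Notation n := n'.+1.
Variables (B : 'M[F]_n) (lam : seq nat).
Notation l := (size lam).
Notation part0 := (nth 0%N lam).
Implicit Types (v : 'M[F]_(l, n)) (A : 'M[F]_n) (Q : 'M[{poly F}]_l).

Lemma eval_mxD m v (P P' : 'M_(m, l)) c :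
  eval_mx B v (P + c%:P *: P') = eval_mx B v P + c *: eval_mx B v P'.
Proof.
apply/row_matrixP => i; rewrite linearD linearZ /= !row_eval_mx scaler_sumr -big_split /=.
apply: eq_bigr => a _; rewrite !mxE rmorphD rmorphM /= horner_mx_C mulmxDr.
by rewrite -[_%:M * _]/(_ *m _) mul_scalar_mx scalemxAr.
Qed.

Lemma eval_mx_constM m k v (G : 'M[F]_(m, k)) (R : 'M_(k, l)) :
  eval_mx B v (map_mx polyC G *m R) = G *m eval_mx B v R.
Proof. by rewrite eval_mxM eval_mx_poly_const. Qed.

Section Acting.
Local Open Scope ring_scope.
Variables (v : 'M[F]_(l, n)) (A : 'M[F]_n) (Q : 'M[{poly F}]_l).
Hypotheses (AB : comm_mx A B) (QA : eval_mx B v Q = v *m A).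

Lemma eval_mx_act m (P : 'M_(m, l)) : eval_mx B v (P *m Q) = eval_mx B v P *m A.
Proof. by rewrite eval_mxM QA eval_mx_comm. Qed.

Lemma eval_mx_exp k : eval_mx B v (Q ^+ k) = v *m A ^+ k.
Proof.
elim: k => [|k IHk]; first by rewrite !expr0 eval_mx1 mulmx1.
by rewrite !exprSr [Q ^+ k * Q]/(_ *m _) eval_mx_act IHk mulmxA.
Qed.

Lemma act_exp_eq0 k : jordan_generators B v -> A ^+ k = 0 <-> torsion part0 (Q ^+ k).
Proof.
move=> gen_v; rewrite -(jordan_generators_torsion (Q ^+ k) gen_v) eval_mx_exp.
split=> [->|vA]; first by rewrite mulmx0.
have [_ [S evS] _] := gen_v.
have AkB : comm_mx (A ^+ k) B by apply/comm_mx_sym/commrX/comm_mx_sym.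
rewrite -[A ^+ k]mul1mx -evS -eval_mx_comm // vA; apply/row_matrixP => i.
by rewrite row_eval_mx row0 big1 // => a _; rewrite row0 mul0mx.
Qed.

(** The relation v_a B^(lam a) = 0 is preserved by A. *)
Lemma act_coef a b k : jordan_generators B v ->
  (Q a b)`_k != 0 -> (part0 b <= part0 a + k)%N.
Proof.
move=> gen_v; apply: contraNT; rewrite -ltnNge => lt_b.
pose P : 'rV[{poly F}]_l := 'X^(part0 a) *: delta_mx 0 a.
have tP : torsion part0 P.
  move=> i c j jc; rewrite !mxE; have [ca|_] := eqVneq c a; last by rewrite andbF mulr0 coef0.
  by rewrite coefXnM -ca jc.
have /jordan_generators_torsion tPQ : eval_mx B v (P *m Q) = 0.
  by rewrite eval_mx_act (jordan_generators_torsion _ gen_v).2 ?mul0mx.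
have := tPQ gen_v 0 b (part0 a + k)%N lt_b.
by rewrite -scalemxAl -rowE !mxE coefXnM ltnNge leq_addr /= addKn => ->.
Qed.

End Acting.

Lemma torsionM m (P : 'M[{poly F}]_(m, l)) Q :
  (forall a b k, (Q a b)`_k != 0 -> (part0 b <= part0 a + k)%N) ->
  torsion part0 P -> torsion part0 (P *m Q).
Proof.
move=> adm tP i b k kb; apply/eqP; apply: contraTT kb.
case/coef_mulmx_neq0 => c [k1 [k2 [<- nz1 /adm le_b]]]; rewrite -leqNgt.
apply: leq_trans le_b _; rewrite leq_add2r leqNgt.
by apply: contra nz1 => /tP ->.
Qed.

(** The condition on Q says that it maps relations to relations, hence it acts on
    the quotient F^n of the free module. *)
Lemma act_exists v Q : jordan_generators B v ->
  (forall a b k, (Q a b)`_k != 0 -> (part0 b <= part0 a + k)%N) ->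
  exists2 A, comm_mx A B & eval_mx B v Q = v *m A.
Proof.
move=> gen_v adm; have [_ [S evS] _] := gen_v.
pose A := eval_mx B v (S *m Q).
have act m (P : 'M_(m, l)) : eval_mx B v (P *m Q) = eval_mx B v P *m A.
  pose G := eval_mx B v P.
  pose P' := P + (-1)%:P *: (map_mx polyC G *m S).
  have tP' : torsion part0 P'.
    apply/(jordan_generators_torsion _ gen_v).
    by rewrite eval_mxD eval_mx_constM evS mulmx1 scaleN1r subrr.
  have /(jordan_generators_torsion _ gen_v) := torsionM adm tP'.
  rewrite mulmxDl -scalemxAl -mulmxA eval_mxD eval_mx_constM scaleN1r.
  by move/eqP; rewrite subr_eq0 => /eqP.
have evX m (P : 'M_(m, l)) : eval_mx B v (P *m 'X%:M) = eval_mx B v P *m B.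
  by rewrite eval_mxM eval_mx_scalar horner_mx_X eval_mx_comm.
exists A; last by have := act _ 1%:M; rewrite mul1mx eval_mx1.
by rewrite /comm_mx -evX -mulmxA scalar_mxC mulmxA act evX evS mul1mx.
Qed.

End Representation.

Section AdaptedGenerators.
Local Open Scope ring_scope.
Variables (F : fieldType) (n' : nat).
Notation n := n'.+1.
Variables (B : 'M[F]_n) (lam : seq nat).
Hypotheses (lam_sorted : sorted geq lam) (lam_gt0 : all (leq 1) lam).
Notation l := (size lam).
Notation part0 := (nth 0%N lam).

Definition mx_at0 m k (Q : 'M[{poly F}]_(m, k)) : 'M[F]_(m, k) :=
  map_mx (horner_eval 0) Q.

Lemma mx_at0E m k (Q : 'M_(m, k)) i j : mx_at0 Q i j = (Q i j)`_0.
Proof. by rewrite mxE /horner_eval horner_coef0. Qed.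

Lemma mx_at0_const m k (G : 'M[F]_(m, k)) : mx_at0 (map_mx polyC G) = G.
Proof. by apply/matrixP => i j; rewrite mx_at0E mxE coefC. Qed.

Lemma mx_at0X m k (Q : 'M_m) : mx_at0 (Q ^+ k) = mx_at0 Q ^+ k.
Proof.
elim: k => [|k IHk]; first by rewrite !expr0 /mx_at0 map_mx1.
by rewrite !exprS -IHk; apply: map_mxM.
Qed.

(** Lift A to a polynomial matrix in the generators [v0].  Its constant term is
    nilpotent, since relations have no constant term, and it respects the lengths
    of the strings.  A matrix that respects these lengths and conjugates the
    constant term into strictly upper triangular form turns [v0] into generators
    with strings of the same lengths. *)
Lemma adapted_generators v0 A k :
  jordan_generators (lam := lam) B v0 -> comm_mx A B -> A ^+ k = 0 ->
  exists v Q, [/\ jordan_generators (lam := lam) B v, strict_mx part0 Q &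
    eval_mx B v Q = v *m A].
Proof.
move=> gen0 AB Ak; have [v0B [S evS] sum_lam] := gen0.
pose Q0 : 'M[{poly F}]_l := map_mx polyC (v0 *m A) *m S.
have ev0 : eval_mx B v0 Q0 = v0 *m A by rewrite eval_mx_constM evS mulmx1.
pose M := mx_at0 Q0.
have part_gt0 (a : 'I_l) : (0 < part0 a)%N by apply/(allP lam_gt0)/mem_nth.
have Mk : M ^+ k = 0.
  rewrite -mx_at0X; apply/matrixP => a b; rewrite mx_at0E mxE.
  have t0 := (act_exp_eq0 AB ev0 k gen0).1 Ak.
  exact: t0.
have fM : respects (fun a : 'I_l => part0 a) M.
  by move=> a b; rewrite mx_at0E => /(act_coef AB ev0 gen0); rewrite addn0.
have f_anti (a b : 'I_l) : (a <= b)%N -> (part0 b <= part0 a)%N := @nth_anti _ lam_sorted a b.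
have [G [H [GH fG fH su]]] := nilpotent_triangularizable f_anti fM Mk.
have HG := mulmx1C GH.
pose v := G *m v0.
have evH m (R : 'M_(m, l)) : eval_mx B v (R *m map_mx polyC H) = eval_mx B v0 R.
  by rewrite eval_mxM eval_mx_poly_const mulmxA HG mul1mx.
have gen_v : jordan_generators (lam := lam) B v.
  split=> //; last by exists (S *m map_mx polyC H); rewrite evH.
  move=> a; rewrite row_mul (mulmx_sum_row (row a G)) mulmx_suml big1 // => b _.
  rewrite mxE -scalemxAl; have [->|/fG/subnKC <-] := eqVneq (G a b) 0.
    by rewrite scale0r.
  by rewrite exprD -[_ * _]/(_ *m _) mulmxA v0B mul0mx scaler0.
pose Q := map_mx polyC G *m Q0 *m map_mx polyC H.
have evQ : eval_mx B v Q = v *m A by rewrite evH eval_mx_constM ev0 mulmxA.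
exists v, Q; split=> // a b j nz; rewrite (act_coef AB evQ gen_v nz) /=.
apply/implyP => /eqP j0; apply: su.
have -> : G *m M *m H = mx_at0 Q.
  by rewrite -{1}[G]mx_at0_const -{1}[H]mx_at0_const /M /mx_at0 -!map_mxM.
by rewrite mx_at0E -j0.
Qed.

End AdaptedGenerators.

(** * Nilpotent matrices with two Jordan blocks *)

Section TwoBlocks.
Local Open Scope ring_scope.
Variables (F : fieldType) (n' : nat).
Notation n := n'.+1.
Implicit Types A : 'M[F]_n.

(** In a vanishing combination of the rows, the functional c attached to the first
    row with a nonzero coefficient isolates that coefficient. *)
Lemma row_free_echelon m k (M : 'M[F]_(m, k)) :
  (forall i, exists c : 'cV_k, row i M *m c != 0 /\
    forall j : 'I_m, (i < j)%N -> row j M *m c = 0) -> row_free M.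
Proof.
move=> ech; rewrite -kermx_eq0; apply/eqP/row_matrixP => r; rewrite row0.
set u := row r _.
have uM : u *m M = 0 by rewrite -row_mul mulmx_ker row0.
suff u0 i : forall j : 'I_m, (j < i)%N -> u 0 j = 0.
  by apply/rowP => j; rewrite [RHS]mxE (u0 j.+1).
elim: i => // i IHi j; rewrite ltnS leq_eqVlt => /orP[/eqP ji|]; last exact: IHi.
have [c [nz c0]] := ech j.
have := congr1 (mulmx^~ c) uM; rewrite mul0mx (mulmx_sum_row u) mulmx_suml (bigD1 j) //=.
rewrite big1 ?addr0 => [|q qj]; last first.
  have [qi|iq|/ord_inj qE] := ltngtP q j; last by rewrite qE eqxx in qj.
    by rewrite IHi ?scale0r ?mul0mx // -ji.
  by rewrite -scalemxAl c0 // scaler0.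
rewrite -scalemxAl => /eqP; rewrite scaler_eq0 (negbTE nz) orbF => /eqP //.
Qed.

(** Write 1 = C v + D A and substitute this equation into its own last term. *)
Lemma nakayama A m (v : 'M[F]_(m, n)) k : A ^+ k = 0 -> (1%:M <= v + A)%MS ->
  exists C : nat -> 'M[F]_(n, m), 1%:M = \sum_(i < k) C i *m v *m A ^+ i.
Proof.
move=> Ak /sub_addsmxP[[C D] /= defC]; exists (fun i => D ^+ i *m C).
suff -> : 1%:M = \sum_(i < k) D ^+ i *m C *m v *m A ^+ i + D ^+ k *m A ^+ k.
  by rewrite Ak mulmx0 addr0.
elim: k {Ak} => [|k IHk]; first by rewrite big_ord0 add0r !expr0 mulmx1.
rewrite {1}IHk big_ord_recr /= -addrA; congr (_ + _).
rewrite -{1}[D ^+ k]mulmx1 defC mulmxDr mulmxDl !mulmxA; congr (_ + _).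
by rewrite exprSr exprS -!mulmxA -!/(_ * _) !mulrA.
Qed.

Lemma nakayama_generators A (lam : seq nat) v k :
  (forall a, row a v *m A ^+ nth 0%N lam a = 0) -> A ^+ k = 0 ->
  (1%:M <= v + A)%MS -> (\sum_(i < size lam) nth 0%N lam i)%N = n ->
  jordan_generators (lam := lam) A v.
Proof.
move=> vA Ak /(nakayama Ak)[C C1] sum_lam; split=> //.
exists (\sum_(i < k) map_mx polyC (C i) *m ('X^i)%:M).
rewrite eval_mx_sum C1; apply: eq_bigr => i _.
by rewrite eval_mx_constM eval_mx_scalar rmorphXn /= horner_mx_X mulmxA.
Qed.

Lemma row_neq0 m k (M : 'M[F]_(m, k)) : M != 0 -> exists i, row i M != 0.
Proof.
case/matrix0Pn => i [j nz]; exists i; apply: contraNneq nz => /rowP/(_ j).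
by rewrite !mxE => ->.
Qed.

Lemma functional_neq0 k (u : 'rV[F]_k) : u != 0 -> exists f : 'cV_k, u *m f = 1%:M.
Proof.
case/rV0Pn => j uj; exists ((u 0 j)^-1 *: delta_mx j 0); rewrite -scalemxAr -colE.
by apply/matrixP => i1 i2; rewrite !ord1 !mxE mulVf ?eqxx.
Qed.

Lemma last_nonzero_exp A (u : 'rV_n) d k : A ^+ k = 0 -> u *m A ^+ d != 0 ->
  exists e, [/\ (d <= e)%N, u *m A ^+ e != 0 & u *m A ^+ e.+1 = 0].
Proof.
move=> Ak ud; have exk : exists e, u *m A ^+ (d + e) == 0.
  by exists k; rewrite exprD Ak mulr0 mulmx0.
case: (ex_minnP exk) => -[|e]; first by rewrite addn0 (negbTE ud).
move=> /eqP ue e_min; exists (d + e)%N; split; [exact: leq_addr| |by rewrite -addnS].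
by apply/negP => /e_min; rewrite ltnn.
Qed.

Lemma exp_mx_eq0 A i j : A ^+ i = 0 -> (i <= j)%N -> A ^+ j = 0.
Proof. by move=> Ai /subnKC <-; rewrite exprD Ai mul0r. Qed.

Lemma row_exp_eq0 A (u : 'rV_n) i j : u *m A ^+ i = 0 -> (i <= j)%N -> u *m A ^+ j = 0.
Proof.
by move=> Ai /subnKC <-; rewrite exprD -[_ * _]/(_ *m _) mulmxA Ai mul0mx.
Qed.

Lemma string_free A (u : 'rV_n) d k : A ^+ k = 0 -> u *m A ^+ d != 0 ->
  row_free (\matrix_(i < d.+1) (u *m A ^+ i)).
Proof.
move=> Ak /(last_nonzero_exp Ak)[e [de ue ue1]]; apply: row_free_echelon => i.
have [f uf] := functional_neq0 ue; have id : (i <= d)%N by rewrite -ltnS.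
exists (A ^+ (e - i) *m f); rewrite rowK mulmxA -(mulmxA u) -[_ *m A ^+ _]/(_ * _).
rewrite -exprD subnKC ?(leq_trans id) // uf; split.
  by apply/eqP => /matrixP/(_ 0 0)/eqP; rewrite !mxE oner_eq0.
move=> j ij; rewrite rowK mulmxA -(mulmxA u) -[_ *m A ^+ _]/(_ * _) -exprD.
by rewrite (row_exp_eq0 ue1) ?mul0mx //; lia.
Qed.

(** Let x have a string of length T, and let f be a functional that is 1 on
    x A^(T-1).  The y with y A^j f = 0 for all j < T form an invariant complement
    of the string of x; its dimension is n - T, hence A^(n-T) vanishes on it.
    Some y in it lies outside the span of x and of the image of A, otherwise x
    would generate and T would be n.  By the rank assumption, x, y and the image
    of A span everything, so x and y generate. *)
Lemma jordan_pair_generators A T : (0 < T < n)%N -> (n - 2 <= \rank A)%N ->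
  A ^+ T = 0 -> A ^+ T.-1 != 0 ->
  exists v, jordan_generators (lam := [:: T; (n - T)%N]) A v.
Proof.
case/andP=> T_gt0 Tn rankA AT /row_neq0[i0]; rewrite rowE.
set x := delta_mx 0 i0 => xA.
have [f xf] := functional_neq0 xA.
pose X := \matrix_(i < T) (x *m A ^+ i).
pose K : 'M_(n, T) := \matrix_(i < n, j < T) (A ^+ j *m f) i 0.
have colK m (u : 'M_(m, n)) (j : 'I_T) : u *m K *m delta_mx j 0 = u *m A ^+ j *m f :> 'M_(m, 1).
  rewrite -mulmxA -colE -mulmxA; congr (_ *m _).
  by apply/matrixP => i1 i2; rewrite !mxE ord1.
have free_XK : row_free (X *m K).
  apply: row_free_echelon => i.
  have lt_i : (T.-1 - i < T)%N by have := ltn_ord i; lia.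
  exists (delta_mx (Ordinal lt_i) 0); rewrite row_mul rowK colK /=.
  rewrite -(mulmxA x) -[_ *m A ^+ _]/(_ * _) -exprD subnKC; last by have := ltn_ord i; lia.
  rewrite xf; split; first by apply/eqP => /matrixP/(_ 0 0)/eqP; rewrite !mxE oner_eq0.
  move=> j ij; rewrite row_mul rowK colK /= -(mulmxA x) -[_ *m A ^+ _]/(_ * _) -exprD.
  by rewrite (exp_mx_eq0 AT) ?mulmx0 ?mul0mx //; have := ltn_ord j; lia.
have unit_XK : X *m K \in unitmx by rewrite -row_free_unit.
pose Pi := 1%:M - K *m invmx (X *m K) *m X.
have PiK : Pi *m K = 0.
  by rewrite mulmxBl mul1mx -!mulmxA mulVmx // mulmx1 subrr.
have x_notin : ~~ (x <= A)%MS.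
  apply: contra xA => /submxP[D ->].
  by rewrite -mulmxA -[A *m _]/(A * _) -exprS prednK // AT mulmx0.
(* Pi projects onto the complement along the string of x. *)
have [y0 y_notin] : exists i, ~~ (row i Pi <= A + x)%MS.
  apply/existsP; apply: contraT => /existsPn all_in; exfalso.
  have PiAx : (Pi <= A + x)%MS by apply/row_subP => i; rewrite -[(_ <= _)%MS]negbK.
  have XAx : (X <= A + x)%MS.
    apply/row_subP => i; rewrite rowK; case: (nat_of_ord i) => [|j].
      by rewrite expr0 mulmx1 addsmxSr.
    by rewrite exprSr -[_ * _]/(_ *m _) mulmxA (submx_trans (submxMl _ _)) // addsmxSl.
  have : (1%:M <= x + A)%MS.
    rewrite addsmxC; have -> : 1%:M = Pi + K *m invmx (X *m K) *m X by rewrite subrK.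
    by rewrite addmx_sub // (submx_trans (submxMl _ _)).
  case/(nakayama AT) => C defC.
  have : (1%:M <= X)%MS.
    rewrite defC summx_sub // => i _; rewrite -mulmxA (submx_trans (submxMl _ _)) //.
    by rewrite -(rowK (fun i : 'I_T => x *m A ^+ i)) row_sub.
  move/mxrankS; rewrite mxrank1 => le_n.
  by have := rank_leq_row X; lia.
pose y := row y0 Pi.
have yK : y *m K = 0 by rewrite -row_mul PiK row0.
have rankK : (T <= \rank K)%N.
  by rewrite -{1}(eqP free_XK) mxrankM_maxr.
have yA : y *m A ^+ (n - T) = 0.
  apply/eqP; apply: contraT => nz; have free_y := string_free AT nz; exfalso.
  set Y := \matrix_(i < _) _ in free_y.
  have YK : Y *m K = 0.
    apply/row_matrixP => i; rewrite row_mul row0 rowK; apply/rowP => j.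
    have /matrixP/(_ 0 0) := colK 1 (y *m A ^+ i) j.
    rewrite -colE [LHS]mxE => ->; rewrite -(mulmxA y) -[_ *m A ^+ _]/(_ * _) -exprD.
    have [ijT|Tij] := ltnP (i + j) T.
      by have := colK 1%N y (Ordinal ijT); rewrite yK mul0mx /= => <-; rewrite !mxE.
    by rewrite (exp_mx_eq0 AT Tij) mulmx0 mul0mx !mxE.
  have /mulmx0_rank_max := YK; rewrite (eqP free_y); lia.
have rank_lt m1 (M : 'M[F]_(m1, n)) (u : 'rV[F]_n) :
    ~~ (u <= M)%MS -> (\rank M < \rank (M + u)%MS)%N.
  move=> uM; apply: rank_ltmx; rewrite ltmxE addsmxSl; apply: contra uM.
  exact: submx_trans (addsmxSr _ _).
pose v : 'M_(size [:: T; (n - T)%N], n) := \matrix_(i < 2) if i == 0 :> nat then x else y.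
have vx : (x <= v)%MS by rewrite (_ : x = row 0 v) ?row_sub ?rowK.
have vy : (y <= v)%MS by rewrite (_ : y = row 1 v) ?row_sub ?rowK.
exists v; apply: (nakayama_generators _ AT); last 1 first.
- by rewrite big_ord_recl big_ord1 /= subnKC // ltnW.
- case=> -[|[|//]] ai; rewrite rowK //=.
  by rewrite AT mulmx0.
apply: submx_trans (_ : (A + x + y <= v + A)%MS); last first.
  by rewrite !addsmx_sub addsmxSr !(submx_trans _ (addsmxSl _ _)).
rewrite sub1mx /row_full eqn_leq rank_leq_col /=.
have lt1 := rank_lt _ _ _ x_notin.
have lt2 : (\rank (A + x) < \rank (A + x + y))%N := rank_lt _ _ _ y_notin.
by move: rankA; lia.
Qed.

(** The bottoms of the strings are independent vectors in the kernel. *)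
Lemma jordan_size_rank A nu v : jordan_generators (lam := nu) A v -> all (leq 1) nu ->
  (size nu + \rank A <= n)%N.
Proof.
move=> gen_v pos; have [vA _ _] := gen_v.
have posn (a : 'I_(size nu)) : (0 < nth 0%N nu a)%N by apply/(allP pos)/mem_nth.
pose Z := \matrix_(a < size nu) (row a v *m A ^+ (nth 0%N nu a).-1).
have ZA : Z *m A = 0.
  apply/row_matrixP => a; rewrite row_mul rowK row0 -mulmxA -[_ *m A]/(_ * _) -exprSr.
  by rewrite prednK.
pose D : 'M[{poly F}]_(size nu) := diag_mx (\row_(b < size nu) 'X^((nth 0%N nu b).-1)).
have evD : eval_mx A v D = Z.
  apply/row_matrixP => a; rewrite row_eval_mx rowK (bigD1 a) //= big1 => [|b /negbTE ba].
    by rewrite !mxE eqxx mulr1n rmorphXn /= horner_mx_X addr0.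
  by rewrite !mxE eq_sym ba rmorph0 mulmx0.
have free_Z : row_free Z.
  apply: inj_row_free => u; rewrite -evD -eval_mx_constM.
  move/(jordan_generators_torsion _ gen_v) => t0; apply/rowP => a.
  have := t0 0 a (nth 0%N nu a).-1; rewrite prednK // => /(_ (leqnn _)).
  by rewrite mul_mx_diag !mxE coefCM coefXn eqxx mulr1.
have := mulmx0_rank_max ZA; rewrite (eqP free_Z); lia.
Qed.

Lemma jordan_exp_eq0 A nu v k : jordan_generators (lam := nu) A v ->
  A ^+ k = 0 <-> forall a, (nth 0%N nu a <= k)%N.
Proof.
move=> gen_v.
have XA : eval_mx A v 'X%:M = v *m A by rewrite eval_mx_scalar horner_mx_X.
have AA : comm_mx A A by [].
have Xk : 'X%:M ^+ k = ('X^k)%:M :> 'M[{poly F}]_(size nu) by rewrite -rmorphXn.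
rewrite (act_exp_eq0 AA XA k gen_v) Xk; split=> [t0 a|le_k a b j jb].
  have [al|/(nth_default 0%N)->//] := ltnP a (size nu).
  rewrite leqNgt; apply/negP => /(t0 (Ordinal al) (Ordinal al)).
  by rewrite !mxE eqxx mulr1n coefXn eqxx => /eqP; rewrite oner_eq0.
rewrite !mxE; case: eqP => _; rewrite ?mulr0n ?coef0 // mulr1n coefXn.
by case: eqP => // jk; have := le_k b; rewrite -jk leqNgt jb.
Qed.

Lemma jordan_pair A T : (0 < T < n)%N -> (n - T <= T)%N -> (n - 2 <= \rank A)%N ->
  A ^+ T = 0 -> A ^+ T.-1 != 0 -> jordan_partition [:: T; (n - T)%N] A.
Proof.
move=> Tn le_T rankA AT AT1.
have [v gen_v] := jordan_pair_generators Tn rankA AT AT1.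
by apply: generators_jordan_partition gen_v; split; rewrite /= ?andbT; lia.
Qed.

(** The rank allows at most two parts, and the index is the largest part. *)
Lemma jordan_pair_unique A T nu : (0 < T < n)%N -> (n - 2 <= \rank A)%N ->
  A ^+ T = 0 -> A ^+ T.-1 != 0 -> jordan_partition nu A -> nu = [:: T; (n - T)%N].
Proof.
move=> Tn rankA AT AT1 jordan_nu; have [[srt pos sum_nu] _] := jordan_nu.
have [v gen_v] := jordan_partition_generators jordan_nu.
have size_nu := jordan_size_rank gen_v pos.
have leT := (jordan_exp_eq0 _ gen_v).1 AT.
have T_le : (T <= head 0 nu)%N.
  rewrite leqNgt; apply: contra AT1 => lt_T; apply/eqP/(jordan_exp_eq0 _ gen_v) => a.
  have := nth_anti srt (leq0n a); rewrite nth0; lia.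
move: T_le (leT 0%N) sum_nu; rewrite nth0.
case: (nu) size_nu => [|a [|b [|c s]]] /= size_nu T_le le_T sum_nu; try lia.
by congr [:: _; _]; lia.
Qed.

(** Each further factor A lowers the rank by 2 at most. *)
Lemma exp_rank_bound A T : A ^+ T = 0 -> (n - 2 <= \rank A)%N -> (n <= T.*2)%N.
Proof.
move=> AT rankA; have rank_exp k : (n <= \rank (A ^+ k) + k.*2)%N.
  elim: k => [|k IHk]; first by rewrite expr0 mxrank1 addn0.
  have := mxrank_mul_min A (A ^+ k); rewrite -[A *m _]/(A * _) -exprS.
  by move: IHk rankA; lia.
by have := rank_exp T; rewrite AT mxrank0.
Qed.

End TwoBlocks.

Section RankOfTwoCycles.
Local Open Scope ring_scope.
Variables (F : fieldType) (n' : nat).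
Notation n := n'.+1.
Variables (B A : 'M[F]_n) (lam : seq nat) (v : 'M[F]_(size lam, n)) (h : nat).
Notation l := (size lam).
Hypotheses (gen_v : jordan_generators B v) (AB : comm_mx A B) (h_lt : (0 < h < l)%N).
Hypothesis cyclesA : eval_mx B v (two_cycles F l h) = v *m A.

Lemma row_two_cycles (a b : 'I_l) p :
  (forall c : 'I_l, two_cycles F l h a c = if c == b then p else 0) ->
  row a v *m A = row b v *m horner_mx B p.
Proof.
move=> Qa; rewrite -row_mul -cyclesA row_eval_mx (bigD1 b) //= Qa eqxx big1 ?addr0 // => c cb.
by rewrite Qa (negbTE cb) rmorph0 mulmx0.
Qed.

(** The image of A contains every generator except the first ones of the two
    cycles, and it contains B times these two.  Together with these two it is
    stable under B, hence everything. *)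
Lemma rank_two_cycles : (n - 2 <= \rank A)%N.
Proof.
have [_ [S evS] _] := gen_v.
have l0 : (0 < l)%N by lia.
have lh : (h < l)%N by lia.
have lh1 : (h.-1 < l)%N by lia.
have ll1 : (l.-1 < l)%N by lia.
pose v0 := row (Ordinal l0) v; pose vh := row (Ordinal lh) v.
pose M := (A + v0 + vh)%MS.
have AM : (A <= M)%MS by rewrite (submx_trans (addsmxSl A v0)) ?addsmxSl.
have v0M : (v0 <= M)%MS by rewrite (submx_trans (addsmxSr A v0)) ?addsmxSl.
have vhM : (vh <= M)%MS by rewrite addsmxSr.
have v0B : v0 *m B = row (Ordinal lh1) v *m A.
  rewrite (row_two_cycles (b := Ordinal l0) (p := 'X)) ?horner_mx_X // => c.
  rewrite mxE -val_eqE /= prednK; last by lia.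
  rewrite eqxx /= (_ : (c == h :> nat) && _ = false) ?add0r; last by lia.
  rewrite (_ : (h == l) = false) ?orbF; last by lia.
  by case: eqP; rewrite ?mul1r ?mul0r.
have vhB : vh *m B = row (Ordinal ll1) v *m A.
  rewrite (row_two_cycles (b := Ordinal lh) (p := 'X)) ?horner_mx_X // => c.
  rewrite mxE -val_eqE /= prednK // eqxx /=.
  rewrite (_ : (l == h) = false) ?orFb; last by lia.
  rewrite (_ : _ && ~~ _ = false) ?add0r; last by have := ltn_ord c; lia.
  by case: eqP; rewrite ?mul1r ?mul0r.
have vM (a : 'I_l) : (row a v <= M)%MS.
  have [a0|a0] := posnP a; first by rewrite (_ : a = Ordinal l0) //; apply: val_inj.
  have [ah|ah] := eqVneq (nat_of_ord a) h; first by rewrite (_ : a = Ordinal lh) //; apply: val_inj.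
  have la1 : (a.-1 < l)%N by have := ltn_ord a; lia.
  have va : row a v = row (Ordinal la1) v *m A.
    rewrite (row_two_cycles (b := a) (p := 1)) ?rmorph1 ?mulmx1 // => c.
    rewrite mxE -val_eqE /= prednK // (_ : _ || _ = false) ?mul0r ?addr0; last first.
      by have := ltn_ord a; lia.
    case: (eqVneq (c : nat) a) => [ca|ca] /=; last by [].
    by rewrite ca ah.
  by rewrite va (submx_trans (submxMl _ _)).
have stable : stablemx M B.
  rewrite addsmxMr addsmx_sub addsmxMr addsmx_sub AB v0B vhB.
  rewrite (submx_trans (submxMl B A) AM).
  by rewrite !(submx_trans (submxMl _ A) AM).
have full : (1%:M <= M)%MS.
  rewrite -evS; apply/row_subP => i; rewrite row_eval_mx summx_sub // => a _.
  by rewrite (submx_trans (submxMr _ (vM a))) // horner_mx_stable.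
have := mxrankS full; rewrite mxrank1.
have := mxrank_adds_leqif A v0; have := mxrank_adds_leqif (A + v0)%MS vh.
case=> + _ [+ _]; have := rank_leq_row v0; have := rank_leq_row vh; rewrite -/M; lia.
Qed.

End RankOfTwoCycles.

(** * Zariski closure along a line *)

Section Zariski.
Local Open Scope ring_scope.
Variables (F : closedFieldType) (n : nat).
Implicit Types (A C D : 'M[F]_n) (p : {mpoly F[n * n]}).

Definition mx_eval p A := p.@[fun k => mxvec A 0 k].

Lemma mx_eval_line p A D : exists P : {poly F}, forall z, P.[z] = mx_eval p (A + z *: D).
Proof.
exists (\sum_(m <- msupp p)
  (p@_m)%:P * \prod_i ((mxvec A 0 i)%:P + (mxvec D 0 i)%:P * 'X) ^+ m i).
move=> z; rewrite /mx_eval mevalE horner_sum; apply: eq_bigr => m _.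
rewrite hornerM hornerC horner_prod; congr (_ * _); apply: eq_bigr => i _.
rewrite horner_exp !hornerE linearD linearZ /= mulrC; congr (_ ^+ _).
by rewrite [RHS]mxE; congr (_ + _); rewrite [RHS]mxE.
Qed.

(** On the line from A to A + D the polynomial p is not identically zero.  If a
    polynomial q vanishes on S, then p q vanishes on the whole line, so q does,
    and in particular at A. *)
Lemma closure_along_line (S : 'M[F]_n -> Prop) p A D :
  mx_eval p (A + D) != 0 -> (forall z, mx_eval p (A + z *: D) != 0 -> S (A + z *: D)) ->
  zariski_closure S A.
Proof.
move=> pD pS Z [I defZ] SZ; apply/defZ => q Iq; rewrite -/(mx_eval q A).
have [P PE] := mx_eval_line p A D; have [Q QE] := mx_eval_line q A D.
have PQ : P * Q = 0.
  apply/eqP; apply: contraT => /exists_nonroot[z].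
  rewrite hornerM mulf_eq0 negb_or PE => /andP[/pS/SZ/defZ/(_ q Iq)].
  by rewrite -/(mx_eval q _) -QE => ->; rewrite eqxx.
have P0 : P != 0 by apply: contraNneq pD => P0; rewrite -[D]scale1r -PE P0 horner0.
move/eqP: PQ; rewrite mulf_eq0 (negbTE P0) /= => /eqP Q0.
by rewrite -[A]addr0 -(scale0r D) -QE Q0 horner0.
Qed.

Definition generic_mx : 'M[{mpoly F[n * n]}]_n := \matrix_(i, j) 'X_(mxvec_index i j).

Definition exp_entry k (i j : 'I_n) : {mpoly F[n * n]} := (generic_mx ^+ k) i j.

(** A minor of the generic matrix after multiplication by constant matrices; with
    those of [minor_witness] it detects the rank of a given matrix. *)
Definition minor r (G : 'M[F]_(r, n)) (H : 'M_(n, r)) : {mpoly F[n * n]} :=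
  \det (map_mx (@mpolyC (n * n) F) G *m generic_mx *m map_mx (@mpolyC (n * n) F) H).

Lemma map_generic_mx A : map_mx (meval (fun k => mxvec A 0 k)) generic_mx = A.
Proof. by apply/matrixP => i j; rewrite !mxE mevalXU mxvecE. Qed.

Lemma mx_eval_exp_entry k i j A : mx_eval (exp_entry k i j) A = (A ^+ k) i j.
Proof.
have <- : map_mx (meval (fun k => mxvec A 0 k)) (generic_mx ^+ k) = A ^+ k.
  elim: k => [|k IHk]; first by rewrite !expr0 map_mx1.
  by rewrite !exprS -IHk -{2}[A]map_generic_mx; apply: map_mxM.
by rewrite mxE.
Qed.

Lemma mx_eval_minor r (G : 'M_(r, n)) H A : mx_eval (minor G H) A = \det (G *m A *m H).
Proof.
rewrite /mx_eval /minor -det_map_mx !map_mxM map_generic_mx -!map_mx_comp.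
congr (\det (_ *m _ *m _)); apply/matrixP => i j; rewrite mxE /=; exact: mevalC.
Qed.

Lemma minor_witness A : exists r (G : 'M_(r, n)) H,
  r = \rank A /\ mx_eval (minor G H) A != 0.
Proof.
exists (\rank A), (pinvmx (col_base A)), (pinvmx (row_base A)); split=> //.
rewrite mx_eval_minor.
have -> : pinvmx (col_base A) *m A = row_base A.
  transitivity (pinvmx (col_base A) *m (col_base A *m row_base A)); first by rewrite mulmx_base.
  by rewrite mulmxA mulVpmx ?col_base_full // mul1mx.
by rewrite mulmxVp ?row_base_free // det1 oner_eq0.
Qed.

Lemma minor_rank r (G : 'M_(r, n)) H A : mx_eval (minor G H) A != 0 -> (r <= \rank A)%N.
Proof.
rewrite mx_eval_minor -unitfE => u; have {}u : G *m A *m H \in unitmx by [].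
rewrite -(mxrank_unit u) (leq_trans (mxrankM_maxl _ _)) //.
exact: mxrankM_maxr.
Qed.

End Zariski.

(** * The generic nilpotent element of the commutator *)

Section Main.
Local Open Scope ring_scope.
Variables (F : closedFieldType) (n' : nat) (lam : seq nat).
Notation n := n'.+1.
Hypotheses (lam_part : is_partition n lam) (r_lam : r_is lam 2).
Notation part0 := (nth 0%N lam).
Notation T := (max_chain lam).
Implicit Types A B : 'M[F]_n.

Let srt : sorted geq lam. Proof. by case: lam_part. Qed.
Let pos : all (leq 1) lam. Proof. by case: lam_part. Qed.
Let sum_lam : sumn lam = n. Proof. by case: lam_part. Qed.
Let part_sum : is_partition (sumn lam) lam. Proof. by rewrite sum_lam. Qed.

Lemma commutator_exp_eq0 B v A Q :
  jordan_generators (lam := lam) B v -> comm_mx A B -> eval_mx B v Q = v *m A ->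
  strict_mx part0 Q -> A ^+ T = 0.
Proof.
move=> gen_v AB QA sQ; apply/(act_exp_eq0 AB QA T gen_v).
exact: strict_mx_torsion.
Qed.

Lemma max_chain_bound : (0 < T < n)%N.
Proof.
have lam_wide := r2_wide part_sum r_lam.
have := max_chain_lt pos lam_wide; rewrite sum_lam => ->; rewrite andbT.
apply: (@chain_size_le_max lam srt pos (0%N, 0%N) [::]) => // z; rewrite inE => /eqP -> /=.
by move: lam_wide; rewrite -nth0 /=; lia.
Qed.

Lemma commutator_index_bound B A : jordan_partition lam B -> nilpotent_commutator B A ->
  A ^+ T = 0.
Proof.
move=> /jordan_partition_generators[v0 gen0] [[k Ak] AB].
have [v [Q [gen_v sQ QA]]] := adapted_generators srt pos gen0 AB Ak.
exact: commutator_exp_eq0 gen_v AB QA sQ.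
Qed.

(** In generators adapted to A, the strict matrices give a linear space inside N_B
    that contains A, a matrix A1 of rank at least n - 2 and a matrix A2 with
    A2^(T-1) <> 0.  On the line through A1 and A2, a minor that is nonzero at A1
    and an entry of the power that is nonzero at A2 are both nonzero at some A0;
    the direction is D = A0 - A. *)
Lemma generic_direction B A : jordan_partition lam B -> nilpotent_commutator B A ->
  exists D p, [/\ forall z, nilpotent_commutator B (A + z *: D),
    mx_eval p (A + D) != 0 &
    forall C, mx_eval p C != 0 -> (n - 2 <= \rank C)%N /\ C ^+ T.-1 != 0].
Proof.
move=> /jordan_partition_generators[v0 gen0] [[k Ak] AB].
have [v [Q [gen_v sQ QA]]] := adapted_generators srt pos gen0 AB Ak.
have act_strict P : strict_mx part0 P -> exists2 C, comm_mx C B & eval_mx B v P = v *m C.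
  move=> sP; apply: act_exists gen_v _ => a b j /sP /andP[] //.
have line P P' C C' z : strict_mx part0 P -> strict_mx part0 P' ->
    comm_mx C B -> comm_mx C' B -> eval_mx B v P = v *m C -> eval_mx B v P' = v *m C' ->
  [/\ strict_mx part0 (P + z%:P *: P'), comm_mx (C + z *: C') B,
      eval_mx B v (P + z%:P *: P') = v *m (C + z *: C') &
      nilpotent_commutator B (C + z *: C')].
  move=> sP sP' CB C'B PC P'C'.
  have sPP' : strict_mx part0 (P + z%:P *: P') by apply/strict_mxD/strict_mxZ.
  have CC'B : comm_mx (C + z *: C') B.
    by rewrite /comm_mx mulmxDl mulmxDr -scalemxAl -scalemxAr CB C'B.
  have evC : eval_mx B v (P + z%:P *: P') = v *m (C + z *: C').
    by rewrite eval_mxD PC P'C' mulmxDr scalemxAr.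
  by split=> //; split=> //; exists T; apply: commutator_exp_eq0 gen_v CC'B evC sPP'.
have [h [h_lt lo hi]] := r2_threshold part_sum r_lam.
have s1 : strict_mx part0 (two_cycles F (size lam) h).
  apply: two_cycles_strict => // a b /andP[ab _]; exact: nth_anti.
have [A1 A1B QA1] := act_strict _ s1.
have rankA1 := rank_two_cycles gen_v A1B h_lt QA1.
have lam_n0 : lam != [::] by case: (lam) h_lt; rewrite ?ltn0 ?andbF.
have [q lam_q TE] := max_chain_attained lam_n0.
have [Q2 [s2 [a [b [_ b_gt0 nz]]]]] := long_walk_uchain F srt pos lam_q.
have [A2 A2B QA2] := act_strict _ s2.
have A2T : A2 ^+ T.-1 != 0.
  apply/eqP => /(act_exp_eq0 A2B QA2 T.-1 gen_v) tors.
  by move: nz; rewrite -TE tors ?eqxx // prednK.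
have [i [j A2ij]] := matrix0Pn _ A2T.
have [r [G [H [rE minorA1]]]] := minor_witness A1; rewrite -rE in rankA1.
pose h1 := minor G H; pose h2 := exp_entry F T.-1 i j.
have [s12 A12B QA12 _] := line _ _ _ _ (-1) s2 s1 A2B A1B QA2 QA1.
have [P1 P1E] := mx_eval_line h1 A1 (A2 + -1 *: A1).
have [P2 P2E] := mx_eval_line h2 A1 (A2 + -1 *: A1).
have [z0] : exists z, (P1 * P2).[z] != 0.
  apply: exists_nonroot; rewrite mulf_neq0 //.
    apply: contraNneq minorA1 => P0.
    by rewrite -[A1]addr0 -(scale0r (A2 + -1 *: A1)) -P1E P0 horner0.
  apply: contraNneq A2ij => P0; rewrite -mx_eval_exp_entry -/h2.
  have -> : A2 = A1 + 1 *: (A2 + -1 *: A1) by rewrite scale1r scaleN1r addrC subrK.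
  by rewrite -P2E P0 horner0.
rewrite hornerM mulf_eq0 negb_or P1E P2E; set A0 := A1 + _ => /andP[h1A0 h2A0].
have [s0 A0B QA0 _] := line _ _ _ _ z0 s1 s12 A1B A12B QA1 QA12.
have [sD DB QD _] := line _ _ _ _ (-1) s0 sQ A0B AB QA0 QA.
have AD : A + (A0 + -1 *: A) = A0 by rewrite scaleN1r addrC subrK.
exists (A0 + -1 *: A), (h1 * h2); split.
- by move=> z; have [] := line _ _ _ _ z sQ sD AB DB QA QD.
- by rewrite AD /mx_eval mevalM mulf_neq0.
move=> C; rewrite /mx_eval mevalM mulf_eq0 negb_or => /andP[/minor_rank le_r].
rewrite -/(mx_eval h2 C) mx_eval_exp_entry => CT; split; first exact: leq_trans le_r.
by apply: contraNneq CT => ->; rewrite mxE.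
Qed.

(** An element of N_B at which a polynomial p of [generic_direction] does not
    vanish has Jordan type (T, n - T), which gives the density.  If O_nu is dense
    in N_B, it meets the open set where such a p does not vanish, so nu is the
    same type. *)
Lemma D_is_max_chain : D_is F n lam [:: T; (n - T)%N].
Proof.
move=> B B_lam; have Tn := max_chain_bound.
have index_le := commutator_index_bound B_lam.
have N0 : nilpotent_commutator B 0.
  by split; [exists 1%N; rewrite expr1 | rewrite /comm_mx mul0mx mulmx0].
have [D0 [p0 [inN0 p0D0 p0P]]] := generic_direction B_lam N0.
have {}inN0 : nilpotent_commutator B (0 + D0) by have := inN0 1; rewrite scale1r.
have [rankD0 _] := p0P _ p0D0.
have n_le : (n - T <= T)%N by have := exp_rank_bound (index_le _ inN0) rankD0; lia.
split.
  split; first by split; rewrite /= ?andbT; lia.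
  split=> [A []//|A NA].
  have [D [p [inN pD pP]]] := generic_direction B_lam NA.
  apply: (closure_along_line pD) => z /pP[rankC CT].
  by split; [apply: jordan_pair => //; apply: index_le | ].
move=> nu [_ [_ dense_nu]]; apply/esym/eqP; apply: contraT => nu_neq.
move: p0D0; apply: contraNT => _.
(* Otherwise O_nu lies in this closed set, which then contains the whole of N_B. *)
have closedZ : zariski_closed (fun C => mx_eval p0 C = 0).
  exists (fun q => q = p0) => C; split=> [pC q -> //|]; exact.
apply/eqP; apply: (dense_nu _ inN0 _ closedZ) => C [nuC NC].
apply/eqP; apply: contraNT nu_neq => /p0P[rankC CT]; apply/eqP.
exact: jordan_pair_unique Tn rankC (index_le _ NC) CT nuC.
Qed.

Lemma max_index_max_chain B : jordan_partition lam B ->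
  is_greatest (fun k => exists A, nilpotent_commutator B A /\ nilpotency_index A k) T.
Proof.
move=> B_lam; have /andP[T_gt0 _] := max_chain_bound.
have index_le := commutator_index_bound B_lam.
have N0 : nilpotent_commutator B 0.
  by split; [exists 1%N; rewrite expr1 | rewrite /comm_mx mul0mx mulmx0].
have [D [p [inN pD pP]]] := generic_direction B_lam N0.
have {}inN : nilpotent_commutator B (0 + D) by have := inN 1; rewrite scale1r.
have [_ DT] := pP _ pD.
split.
  exists (0 + D); split=> //; split=> [|k [_ Dk]]; first by split=> //; apply: index_le.
  rewrite leqNgt; apply: contra DT => lt_k; apply/eqP.
  by apply: exp_mx_eq0 Dk _; lia.
by move=> k [A [NA [_ least]]]; apply: least; split=> //; apply: index_le.
Qed.

End Main.

Theorem theorem4p2 (F : closedFieldType) (n : nat) (lam : seq nat)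
    (lam_part : is_partition n lam) (r_lam : r_is lam 2)
    (B : 'M[F]_n) (B_nilp : mx_nilpotent B) (B_lam : jordan_partition lam B) :
  exists i_lam : nat,
    [/\ D_is F n lam [:: i_lam; (n - i_lam)%N],
        is_greatest
          (fun k => exists A : 'M[F]_n,
             nilpotent_commutator B A /\ nilpotency_index A k) i_lam
      & is_greatest (index_candidate lam) i_lam].
Proof.
have [srt pos sum_lam] := lam_part.
have part_sum : is_partition (sumn lam) lam by rewrite sum_lam.
have lam_wide := r2_wide part_sum r_lam.
case: n lam_part B B_nilp B_lam sum_lam => [|n'] lam_part B _ B_lam sum_lam.
  by have := max_chain_lt pos lam_wide; rewrite sum_lam.
exists (max_chain lam); split.
- exact: D_is_max_chain.
- exact: max_index_max_chain.
split; last by move=> k; apply: candidate_le_max_chain.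
apply: max_chain_candidate => //.
by case: (lam) lam_wide => [|x [|y s]] //=; rewrite subnn.
Qed.
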